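(* Let $R$ be a left artinian ring and $M$ a finitely generated $(n,p)$-eventually periodic $R$-module with $\operatorname{Gpd}_R M = r < \infty$. Then the following assertions hold. (1) $r \leq n \leq r+1$, and $\Omega_{R}^{r+p}(M) \oplus P \cong \Omega_{R}^{r}(M)$ as $R$-modules for some finitely generated projective $R$-module $P$. (2) $n=r$ if and only if $\Omega_{R}^{r}(M)$ has no non-zero projective direct summand. (3) Suppose $n\ge 1$. If we write $\Omega_{R}^{n-1}(M) = X \oplus Q$ with $X$ a finitely generated $R$-module having no non-zero projective direct summand and $Q$ a finitely generated projective $R$-module, then $r=n-1$ if and only if $X \cong \Omega_{R}^{n+p-1}(M)$ as $R$-modules.
   Context: Rings are associative and unital; modules are left modules. The syzygy $\Omega_R(M)$ is the kernel of a projective cover $P\to M$; set $\Omega_R^0(M)=M$ and $\Omega_R^n(M)=\Omega_R(\Omega_R^{n-1}(M))$. An $R$-module $M$ is periodic if $\Omega_R^p(M)\cong M$ as $R$-modules for some $p>0$; the smallest such $p$ is its period. For $n\ge 0$ and $p>0$, $M$ is $(n,p)$-eventually periodic if $n$ is the smallest non-negative integer such that $\Omega_R^n(M)$ is periodic, and $\Omega_R^n(M)$ has period $p$. An acyclic complex $T_\bullet$ of projective $R$-modules is totally acyclic if $\operatorname{Hom}_R(T_\bullet,Q)$ is acyclic for every projective $R$-module $Q$. An $R$-module is Gorenstein projective if it is isomorphic to the cokernel of $T_1\to T_0$ for some totally acyclic complex $T_\bullet$. The Gorenstein projective dimension $\operatorname{Gpd}_R M$ is the infimum of the lengths $n$ of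 exact sequences $0\to G_n\to\cdots\to G_0\to M\to 0$ with all $G_i$ Gorenstein projective. *)

(* Defs.v *)
From HB Require Import structures.
From mathcomp Require Import all_boot all_order all_algebra.
From mathcomp Require Import boolp.

Set Implicit Arguments.
Unset Strict Implicit.
Unset Printing Implicit Defensive.

Import GRing.Theory.
Local Open Scope ring_scope.

(* Rings are [pzRingType]s (associative, unital, possibly zero) and left
   modules are [lmodType]s.  Submodules are boolean predicates satisfying
   [submod_closed]; in the presence of the axioms of [boolp] every
   propositional predicate is of this form. *)

Definition left_artinian (R : pzRingType) : Prop :=
  forall I : nat -> {pred R^o},
    (forall k, submod_closed (I k)) ->
    (forall k, {subset I k.+1 <= I k}) ->
    exists N, forall k, (N <= k)%N -> I k =i I N.

Section Modules.
Variable R : pzRingType.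
Implicit Types A B K M N P Q X Y : lmodType R.

Definition fin_gen M : Prop :=
  exists (k : nat) (g : 'I_k -> M),
    forall x, exists c : 'I_k -> R, x = \sum_(i < k) c i *: g i.

Definition iso M N : Prop := exists f : {linear M -> N}, bijective f.

Definition surj A B (f : A -> B) : Prop := forall y, exists x, f x = y.

(* exactness of A -> B -> C at B *)
Definition exact_at (A B C : lmodType R) (f : A -> B) (g : B -> C) : Prop :=
  forall y, g y = 0 <-> exists x, f x = y.

Definition projective P : Prop :=
  forall A B (g : {linear A -> B}) (f : {linear P -> B}),
    surj g -> exists h : {linear P -> A}, forall x, g (h x) = f x.

Definition no_proj_summand M : Prop :=
  forall P Y, projective P -> iso M (P * Y)%type -> forall x : P, x = 0.

Definition superfluous_ker P M (f : {linear P -> M}) : Prop :=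
  forall S : {pred P}, submod_closed S ->
    (forall x, exists y z, [/\ y \in S, f z = 0 & x = y + z]) ->
    forall x, x \in S.

Definition projective_cover P M (f : {linear P -> M}) : Prop :=
  [/\ projective P, surj f & superfluous_ker f].

Definition is_syzygy M K : Prop :=
  exists (P : lmodType R) (f : {linear P -> M}) (i : {linear K -> P}),
    [/\ projective_cover f, injective i & exact_at i f].

(* A chosen kernel of a projective cover.  The default value is only reached
   by modules without a projective cover, and there are none over a left
   artinian (hence left perfect) ring. *)
Definition syzygy M : lmodType R :=
  if pselect (exists K, is_syzygy M K) is left h then projT1 (cid h) else M.

Definition Omega (n : nat) M : lmodType R := iter n syzygy M.

Definition periodic M : Prop := exists2 p, (0 < p)%N & iso (Omega p M) M.

Definition has_period M (p : nat) : Prop :=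
  [/\ (0 < p)%N, iso (Omega p M) M &
      forall q, (0 < q)%N -> iso (Omega q M) M -> (p <= q)%N].

Definition eventually_periodic (n p : nat) M : Prop :=
  [/\ periodic (Omega n M),
      forall m, periodic (Omega m M) -> (n <= m)%N &
      has_period (Omega n M) p].

(* Differentials are indexed by their target, d i : T (i + 1) -> T i, so that
   exactness at every spot reads as exactness at T (i + 1) for all i : int. *)
Definition acyclic (T : int -> lmodType R)
    (d : forall i, {linear T (i + 1) -> T i}) : Prop :=
  forall i, exact_at (d (i + 1)) (d i).

(* Exactness of Hom(T i, Q) -> Hom(T (i + 1), Q) -> Hom(T (i + 1 + 1), Q). *)
Definition Hom_acyclic (T : int -> lmodType R)
    (d : forall i, {linear T (i + 1) -> T i}) Q : Prop :=
  forall i (g : {linear T (i + 1) -> Q}),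
    (forall x, g (d (i + 1) x) = 0) <->
    exists h : {linear T i -> Q}, forall x, h (d i x) = g x.

Definition totally_acyclic (T : int -> lmodType R)
    (d : forall i, {linear T (i + 1) -> T i}) : Prop :=
  [/\ forall i, projective (T i), acyclic d &
      forall Q, projective Q -> Hom_acyclic d Q].

(* The map e exhibits M as a cokernel of d 0 : T 1 -> T 0. *)
Definition Gorenstein_projective M : Prop :=
  exists (T : int -> lmodType R) (d : forall i, {linear T (i + 1) -> T i})
    (e : {linear T 0 -> M}),
    [/\ totally_acyclic d, surj e & exact_at (d 0) e].

(* An exact sequence 0 -> G n -> ... -> G 0 -> M -> 0, extended by zero
   modules in degrees above n. *)
Definition Gproj_resolution M (n : nat) : Prop :=
  exists (G : nat -> lmodType R) (d : forall i, {linear G i.+1 -> G i})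
    (e : {linear G 0%N -> M}),
    [/\ forall i, (i <= n)%N -> Gorenstein_projective (G i),
        forall i, (n < i)%N -> forall x : G i, x = 0,
        surj e,
        exact_at (d 0%N) e &
        forall i, exact_at (d i.+1) (d i)].

(* Gpd M = r with r finite *)
Definition Gpd_eq M (r : nat) : Prop :=
  Gproj_resolution M r /\ forall m, Gproj_resolution M m -> (r <= m)%N.

End Modules.

(* Main.v *)
From HB Require Import structures.
From mathcomp Require Import all_boot all_order all_algebra.
From mathcomp Require Import boolp classical_sets functions.
Require Import Defs.

(** Write [L k] for the syzygy of degree [k] of [M].

    The Gorenstein projective dimension [r] enters in two ways.  First, a
    Gorenstein projective resolution of length [r] forces [Ext^i(L k, Q) = 0] for
    all [k >= r], [i > 0] and projective [Q] ([Omega_ext_acyclic]); this is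
    dimension shifting, with the vanishing of these extension groups in place
    of Gorenstein projectivity.  Conversely, a periodic [L n] with vanishing
    extensions is Gorenstein projective, because running through its period in
    both directions gives a complete resolution ([periodic_Gorenstein]); since
    [L n] is isomorphic to syzygies of arbitrarily high degree, the vanishing
    holds for it, and [r <= n] follows by minimality of [r].

    If [Ext^1(X, Q) = 0] for all projective [Q], then a projective summand of the
    syzygy of [X] would extend to a summand of the projective cover contained in
    its superfluous kernel ([syzygy_no_proj_summand]).  So the modules [L k] with
    [k > r] have no projective summand.  For finitely generated modules with this
    vanishing and without projective summands, an isomorphism of the syzygies
    comes from an isomorphism of the modules ([iso_of_syzygy_iso]): it extends to
    the projective covers, and the resulting composites differ from the identity
    by maps through projectives, which are nilpotent by Fitting's lemma
    ([nilpotent_through_proj]).  Hence the isomorphism of [L (n + p)] and [L n]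
    descends to one of [L (r + 1 + p)] and [L (r + 1)], and [n <= r + 1].  One more
    descent, applied to the part [X] of [L r = X + Q] without projective
    summands, gives that [X] is isomorphic to [L (r + p)].  All three assertions
    are read off from this.

    The chain conditions that this requires are provided by the theorem of
    Hopkins: over a left artinian ring every artinian module is finitely
    generated ([artin_fg]).  It is proved by studying an artinian module that is
    not finitely generated while all its proper submodules are.  It yields projective covers and Fitting's lemma for
    finitely generated modules. *)

Set Implicit Arguments.
Unset Strict Implicit.
Unset Printing Implicit Defensive.

Import GRing.Theory.
Local Open Scope ring_scope.

(** * Submodules and linear maps *)

Section Submodules.
Variable R : pzRingType.

(** Submodules as [Prop]-valued predicates, so that kernels, images, spans and
    annihilators are given by plain formulas. *)
Definition submodP (V : lmodType R) (S : V -> Prop) : Prop :=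
  S 0 /\ forall a x y, S x -> S y -> S (a *: x + y).

Section Closure.
Variables (V : lmodType R) (S : V -> Prop).
Hypothesis hS : submodP S.

Lemma submodD x y : S x -> S y -> S (x + y).
Proof. by case: hS => _ h Sx Sy; rewrite -[x]scale1r; apply: h. Qed.

Lemma submodZ a x : S x -> S (a *: x).
Proof. by case: hS => h0 h Sx; rewrite -[_ *: x]addr0; apply: h. Qed.

Lemma submodN x : S x -> S (- x).
Proof. by move=> Sx; rewrite -scaleN1r; apply: submodZ. Qed.

Lemma submodB x y : S x -> S y -> S (x - y).
Proof. by move=> Sx Sy; apply: submodD => //; apply: submodN. Qed.

End Closure.

Lemma submodP_closed (V : lmodType R) (S : V -> Prop) :
  submodP S -> submod_closed ([pred x | `[< S x >]] : {pred V}).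
Proof.
move=> [h0 h]; split; first by apply/asboolP.
by move=> a x y /asboolP Sx /asboolP Sy; apply/asboolP; apply: h.
Qed.

Lemma closed_submodP (V : lmodType R) (S : {pred V}) :
  submod_closed S -> submodP (fun x => x \in S).
Proof. by move=> [h0 h]; split=> // a x y; apply: h. Qed.

Lemma mk_linear (A B : lmodType R) (f : A -> B) :
  (forall a x y, f (a *: x + y) = a *: f x + f y) ->
  exists g : {linear A -> B}, forall x, g x = f x.
Proof.
move=> h; have lf : linear f by [].
pose L := GRing.isLinear.Build R A B *:%R f lf.
pose g : {linear A -> B} := HB.pack f L.
by exists g.
Qed.

(** Single-valuedness only has to be tested at [0], so that a map defined by
    choosing representatives needs no well-definedness proof beyond that. *)
Lemma linear_of_graph (A B : lmodType R) (G : A -> B -> Prop) :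
  (forall x, exists y, G x y) ->
  (forall y, G 0 y -> y = 0) ->
  (forall a x y x' y', G x y -> G x' y' -> G (a *: x + x') (a *: y + y')) ->
  exists f : {linear A -> B}, forall x, G x (f x).
Proof.
move=> tot uniq lin.
pose f x := projT1 (cid (tot x)).
have Gf x : G x (f x) by rewrite /f; case: cid.
have Guniq x y y' : G x y -> G x y' -> y = y'.
  move=> Gy Gy'; apply/eqP; rewrite -subr_eq0; apply/eqP; apply: uniq.
  rewrite -(subrr x) -[- x]scaleN1r -[- y']scaleN1r [x + _]addrC [y + _]addrC.
  exact: lin.
have [|g gE] := @mk_linear _ _ f.
  by move=> a x y; apply: (Guniq (a *: x + y)) => //; apply: lin.
by exists g => x; rewrite gE.
Qed.

Lemma linear_factor (A B C : lmodType R) (s : {linear A -> B})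
    (t : {linear A -> C}) :
  surj s -> (forall x, s x = 0 -> t x = 0) ->
  exists u : {linear B -> C}, forall x, u (s x) = t x.
Proof.
move=> ss st.
have [|y [x []]|a y z y' z' [x [<- <-]] [x' [<- <-]]|u hu] :=
  @linear_of_graph B C (fun y z => exists x, s x = y /\ t x = z).
- by move=> y; have [x <-] := ss y; exists (t x), x.
- by move/st => -> <-.
- by exists (a *: x + x'); rewrite !linearP.
exists u => x; have [x' [xx' <-]] := hu (s x).
by apply/eqP; rewrite -subr_eq0 -linearB st // linearB xx' subrr.
Qed.

Lemma linear_lift (A B C : lmodType R) (i : {linear B -> C})
    (t : {linear A -> C}) :
  injective i -> (forall x, exists y, i y = t x) ->
  exists u : {linear A -> B}, forall x, i (u x) = t x.
Proof.
move=> ii it.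
apply: (@linear_of_graph A B (fun x y => i y = t x)) => //.
- by move=> y; rewrite linear0 -[RHS](linear0 i) => /ii.
- by move=> a x y x' y' h h'; rewrite !linearP h h'.
Qed.

Lemma linear_inverse (A B : lmodType R) (f : {linear A -> B}) :
  injective f -> surj f -> exists g : {linear B -> A}, cancel f g /\ cancel g f.
Proof.
move=> fi fs; have [g gE] := linear_lift (t := idfun) fi fs.
by exists g; split=> x; [apply: fi; rewrite gE|exact: gE].
Qed.

Lemma linear_inj (A B : lmodType R) (f : {linear A -> B}) :
  (forall x, f x = 0 -> x = 0) -> injective f.
Proof.
by move=> h x y e; apply/eqP; rewrite -subr_eq0 (h (x - y)) // linearB e subrr.
Qed.

Lemma iso_of_bij (A B : lmodType R) (f : {linear A -> B}) :
  injective f -> surj f -> iso A B.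
Proof.
by move=> fi fs; have [g [h1 h2]] := linear_inverse fi fs; exists f, g.
Qed.

Lemma iso_inv (A B : lmodType R) : iso A B ->
  exists (f : {linear A -> B}) (g : {linear B -> A}), cancel f g /\ cancel g f.
Proof.
move=> [f [g' h1 h2]]; exists f; apply: linear_inverse.
  exact: can_inj h1.
by move=> y; exists (g' y).
Qed.

Lemma iso_refl (A : lmodType R) : iso A A.
Proof. by exists idfun, idfun. Qed.

Lemma iso_sym (A B : lmodType R) : iso A B -> iso B A.
Proof. by move=> /iso_inv[f [g [h1 h2]]]; exists g, f. Qed.

Lemma iso_trans (A B C : lmodType R) : iso A B -> iso B C -> iso A C.
Proof.
move=> /iso_inv[f [f' [h1 h2]]] /iso_inv[g [g' [h3 h4]]].
by exists (g \o f), (f' \o g') => x /=; rewrite ?h3 ?h1 ?h2 ?h4.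
Qed.

Lemma prod_map (A B C : lmodType R) (f : {linear C -> A}) (g : {linear C -> B}) :
  exists h : {linear C -> (A * B)%type}, forall x, h x = (f x, g x).
Proof. by apply: mk_linear => a x y; rewrite !linearP. Qed.

Lemma coprod_map (A B C : lmodType R) (f : {linear A -> C})
    (g : {linear B -> C}) :
  exists h : {linear (A * B)%type -> C}, forall x, h x = f x.1 + g x.2.
Proof.
by apply: mk_linear => a x y /=; rewrite !linearP scalerDr addrACA.
Qed.

Lemma prod_functor (A B A' B' : lmodType R) (f : {linear A -> A'})
    (g : {linear B -> B'}) :
  exists h : {linear (A * B)%type -> (A' * B')%type},
    forall x, h x = (f x.1, g x.2).
Proof. by apply: mk_linear => a x y /=; rewrite !linearP. Qed.

Lemma iso_prod (A B A' B' : lmodType R) :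
  iso A A' -> iso B B' -> iso (A * B)%type (A' * B')%type.
Proof.
move=> /iso_inv[f [f' [h1 h2]]] /iso_inv[g [g' [h3 h4]]].
have [h hE] := prod_functor f g; have [h' hE'] := prod_functor f' g'.
by exists h, h' => -[x y]; rewrite hE hE' /= ?h1 ?h2 ?h3 ?h4.
Qed.

Lemma sub_lmod (V : lmodType R) (S : V -> Prop) : submodP S ->
  exists (K : lmodType R) (i : {linear K -> V}),
    injective i /\ forall y, S y <-> exists x, i x = y.
Proof.
move=> hS; pose P : {pred V} := [pred x | `[< S x >]].
have cP : submod_closed P := submodP_closed hS.
pose T := {x : V | P x}.
pose K : GRing.SubLmodule.type P :=
  HB.pack T (GRing.SubChoice_isSubLmodule.Build R V P T
               (GRing.submod_closed_semi cP)).
have [|i iE] := @mk_linear K V (fun x : K => val x).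
  by move=> a x y; rewrite linearP.
exists K, i; split=> [x y|y]; first by rewrite !iE => /val_inj.
split=> [Sy|[x <-]].
  have Py : P y by apply/asboolP.
  by exists (exist _ y Py : K); rewrite iE.
by rewrite iE; apply/asboolP; exact: (valP x).
Qed.

End Submodules.

(** * Artinian modules over a left artinian ring are finitely generated *)

Section Spans.
Variable R : pzRingType.
Implicit Types V W : lmodType R.

Fixpoint lspan V (s : seq V) (x : V) : Prop :=
  if s is g :: s' then exists (a : R) (y : V), lspan s' y /\ x = a *: g + y
  else x = 0.

Definition fg V (S : V -> Prop) : Prop :=
  exists s : seq V, forall x, S x <-> lspan s x.

Definition sumS V (A B : V -> Prop) (x : V) : Prop :=
  exists a b, [/\ A a, B b & x = a + b].

Lemma lspan_submod V (s : seq V) : submodP (lspan s).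
Proof.
elim: s => [|g s [h0 h]] /=; split=> //.
- by move=> a x y -> ->; rewrite scaler0 addr0.
- by exists 0, 0; rewrite scale0r addr0.
move=> a x y [b [x' [sx ->]]] [c [y' [sy ->]]].
exists (a * b + c), (a *: x' + y'); split; first exact: h.
by rewrite scalerDr scalerA addrACA -scalerDl.
Qed.

Lemma mem_lspan V (s : seq V) g : g \in s -> lspan s g.
Proof.
elim: s => //= h s IH; rewrite in_cons => /orP[/eqP ->|/IH sg].
  by exists 1, 0; rewrite scale1r addr0; split=> //; case: (lspan_submod s).
by exists 0, g; rewrite scale0r add0r.
Qed.

Lemma lspan_min V (s : seq V) (S : V -> Prop) :
  submodP S -> (forall g, g \in s -> S g) -> forall x, lspan s x -> S x.
Proof.
move=> hS; elim: s => [|g s IH] /= hs x; first by move=> ->; case: hS.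
move=> [a [y [sy ->]]]; case: hS => _; apply; first by apply: hs; rewrite mem_head.
by apply: IH => // k ks; apply: hs; rewrite in_cons ks orbT.
Qed.

Lemma sum_submod V (A B : V -> Prop) :
  submodP A -> submodP B -> submodP (sumS A B).
Proof.
move=> [A0 hA] [B0 hB]; split; first by exists 0, 0; rewrite addr0.
move=> c x y [a [b [Aa Bb ->]]] [a' [b' [Aa' Bb' ->]]].
exists (c *: a + a'), (c *: b + b'); split; [exact: hA|exact: hB|].
by rewrite scalerDr addrACA.
Qed.

Lemma sum_l V (A B : V -> Prop) x : submodP B -> A x -> sumS A B x.
Proof. by move=> [B0 _] Ax; exists x, 0; rewrite addr0. Qed.

Lemma sum_r V (A B : V -> Prop) x : submodP A -> B x -> sumS A B x.
Proof. by move=> [A0 _] Bx; exists 0, x; rewrite add0r. Qed.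

Lemma fg_sum V (A B : V -> Prop) : fg A -> fg B -> fg (sumS A B).
Proof.
move=> [s hs] [t ht]; exists (s ++ t) => x; split.
  move=> [a [b [/hs sa /ht tb ->]]]; apply: submodD (lspan_submod _) _ _ _ _.
    apply: (lspan_min (lspan_submod _)) sa => g gs.
    by apply: mem_lspan; rewrite mem_cat gs.
  apply: (lspan_min (lspan_submod _)) tb => g gs.
  by apply: mem_lspan; rewrite mem_cat gs orbT.
have sA : submodP A.
  have [h0 h] := lspan_submod s; split; first exact/hs.
  by move=> a u v /hs su /hs sv; apply/hs/h.
have sB : submodP B.
  have [h0 h] := lspan_submod t; split; first exact/ht.
  by move=> a u v /ht su /ht sv; apply/ht/h.
apply: lspan_min; first exact: sum_submod.
move=> g; rewrite mem_cat => /orP[] /mem_lspan gs.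
  by apply: sum_l => //; apply/hs.
by apply: sum_r => //; apply/ht.
Qed.

Lemma fg_ext V (A B : V -> Prop) : (forall x, A x <-> B x) -> fg A -> fg B.
Proof. by move=> AB [s hs]; exists s => x; rewrite -AB. Qed.

Definition cyc V (x y : V) : Prop := exists a, y = a *: x.

Lemma cyc_submod V (x : V) : submodP (cyc x).
Proof.
split; first by exists 0; rewrite scale0r.
by move=> a y z [b ->] [c ->]; exists (a * b + c); rewrite scalerDl scalerA.
Qed.

Lemma cyc_id V (x : V) : cyc x x.
Proof. by exists 1; rewrite scale1r. Qed.

Lemma fg_cyc V (x : V) : fg (cyc x).
Proof.
exists [:: x] => y; split=> [[a ->]|[a [z [-> ->]]]].
  by exists a, 0; rewrite addr0.
by exists a; rewrite addr0.
Qed.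

Lemma cyc_min V (S : V -> Prop) x y : submodP S -> S x -> cyc x y -> S y.
Proof. by move=> hS Sx [a ->]; apply: submodZ. Qed.

Lemma lspan_map V W (f : {linear V -> W}) s y :
  lspan (map f s) y -> exists x, lspan s x /\ f x = y.
Proof.
elim: s y => /= [|g s IH] y; first by move=> ->; exists 0; rewrite linear0.
move=> [a [z [/IH[x [sx <-]] ->]]]; exists (a *: g + x); rewrite linearP.
by split=> //; exists a, x.
Qed.

Lemma map_lspan V W (f : {linear V -> W}) s x :
  lspan s x -> lspan (map f s) (f x).
Proof.
elim: s x => /= [|g s IH] x; first by move=> ->; rewrite linear0.
by move=> [a [z [/IH sx ->]]]; exists a, (f z); rewrite linearP.
Qed.

Lemma preimage_seq (T W : eqType) (L : T -> Prop) (f : T -> W) (s : seq W) :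
  (forall g, g \in s -> exists2 l, L l & f l = g) ->
  exists t : seq T, (forall l, l \in t -> L l) /\ map f t = s.
Proof.
elim: s => [|g s IH] h; first by exists [::].
have [|t [ht <-]] := IH; first by move=> k ks; apply: h; rewrite in_cons ks orbT.
have [l Ll <-] := h g (mem_head _ _).
by exists (l :: t); split=> // k; rewrite in_cons => /orP[/eqP ->|/ht].
Qed.

Definition artin V (S : V -> Prop) : Prop :=
  forall I : nat -> V -> Prop,
    (forall k, submodP (I k)) -> (forall k x, I k x -> S x) ->
    (forall k x, I k.+1 x -> I k x) ->
    exists N, forall k, (N <= k)%N -> forall x, I N x -> I k x.

(** If no member were minimal, dependent choice would produce a strictly
    descending chain. *)
Lemma artin_min V (S : V -> Prop) (F : (V -> Prop) -> Prop) : artin S ->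
  (forall A, F A -> submodP A /\ forall x, A x -> S x) ->
  (exists A, F A) ->
  exists A, F A /\ forall B, F B -> (forall x, B x -> A x) ->
            forall x, A x -> B x.
Proof.
move=> aS FS [A0 FA0]; apply: contrapT => nomin.
have next (A : {A | F A}) :
    exists B : {B | F B}, (forall x, sval B x -> sval A x) /\
                          ~ (forall x, sval A x -> sval B x).
  case: A => A FA /=; apply: contrapT => nB; apply: nomin; exists A.
  split=> // B FB BA; apply: contrapT => nAB; apply: nB.
  by exists (exist _ B FB).
pose step A := projT1 (cid (next A)).
have stepP A : (forall x, sval (step A) x -> sval A x) /\
               ~ (forall x, sval A x -> sval (step A) x).
  by rewrite /step; case: cid.
pose I k := iter k step (exist _ A0 FA0).
have [k|k x|k x|N hN] := aS (fun k => sval (I k)).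
- by have [] := FS _ (svalP (I k)).
- by have [_] := FS _ (svalP (I k)); apply.
- by have [+ _] := stepP (I k); apply.
by have [_] := stepP (I N); apply=> x; apply: (hN N.+1 (leqnSn N) x).
Qed.

Hypothesis hR : left_artinian R.

Lemma artin_ring (S : R^o -> Prop) : artin S.
Proof.
move=> I hI _ dec.
have [k|k x|N hN] := hR (I := fun k => [pred x | `[< I k x >]]).
- exact: submodP_closed.
- by move=> /asboolP Ix; apply/asboolP/dec.
exists N => k Nk x Ix; have := hN k Nk x.
by rewrite !inE => e; apply/asboolP; rewrite e; apply/asboolP.
Qed.

Lemma artin_sub V (S T : V -> Prop) :
  artin S -> (forall x, T x -> S x) -> artin T.
Proof. by move=> aS TS I hI IT dec; apply: aS => // k x /IT/TS. Qed.

Lemma chain_le V (I : nat -> V -> Prop) :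
  (forall k x, I k.+1 x -> I k x) ->
  forall m k, (m <= k)%N -> forall x, I k x -> I m x.
Proof.
move=> dec m k /subnKC <-; elim: (k - m)%N => [|j IH] x; first by rewrite addn0.
by rewrite addnS => /dec/IH.
Qed.

(** A chain in [R x0 + S] is controlled by two chains: its trace on [S], and the
    left ideals formed by the coefficients of [x0]. *)
Lemma artin_step V (S : V -> Prop) x0 :
  submodP S -> artin S -> artin (sumS (cyc x0) S).
Proof.
move=> hS aS I hI IS dec.
have [k|k x []//|k x [Ix Sx]|N hN] := aS (fun k x => I k x /\ S x).
- have [I0 hk] := hI k; have [S0 hs] := hS; split=> // a x y [? ?] [? ?].
  by split; [apply: hk|apply: hs].
- by split=> //; apply: dec.
have [k|//|k a [s [Ss Ik]]|N' hN'] := @artin_ring (fun _ => True)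
    (fun k a => exists s, S s /\ I k ((a : R) *: x0 + s)).
- split; first by exists 0; rewrite scale0r addr0; case: hS; case: (hI k).
  move=> a b c [s [Ss Is]] [t [St It]]; exists (a *: s + t).
  split; first by case: hS => _; apply.
  rewrite scalerDl -scalerA addrACA -scalerDr.
  by case: (hI k) => _; apply.
- by exists s; split=> //; apply: dec.
have le := chain_le dec.
exists (maxn N N') => k; rewrite geq_max => /andP[Nk N'k] x Ix.
have [_ [s [[a ->] Ss xE]]] := IS _ _ Ix.
have [|t [St It]] := hN' k N'k a.
  by exists s; split=> //; rewrite -xE; apply: le Ix; apply: leq_maxr.
have Ist : I N (s - t).
  have -> : s - t = x - (a *: x0 + t) by rewrite xE opprD addrACA subrr add0r.
  apply: submodB (hI N) _ _ _ _; first by apply: le Ix; apply: leq_maxl.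
  exact: le It.
have [Ik _] := hN k Nk _ (conj Ist (submodB hS Ss St)).
have -> : x = (s - t) + (a *: x0 + t).
  by rewrite xE addrA addrAC addrC subrK addrC.
exact: submodD.
Qed.

Lemma artin_lspan V (s : seq V) : artin (lspan s).
Proof.
elim: s => [|g s IH] /=.
  move=> I hI I0 _; exists 0 => k _ x /I0 ->.
  by case: (hI k).
apply: artin_sub (artin_step (x0 := g) (lspan_submod s) IH) _.
by move=> x [a [y [sy ->]]]; exists (a *: g), y; split=> //; exists a.
Qed.

Definition prodS V (L : R^o -> Prop) (N : V -> Prop) (x : V) : Prop :=
  forall T, submodP T -> (forall (l : R) n, L l -> N n -> T (l *: n)) -> T x.

Lemma prod_submod V L (N : V -> Prop) : submodP (prodS L N).
Proof.
split; first by move=> T [].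
by move=> a x y hx hy T hT hl; case: (hT) => _; apply; [apply: hx|apply: hy].
Qed.

Lemma mem_prod V (L : R^o -> Prop) (N : V -> Prop) (l : R) n :
  L l -> N n -> prodS L N (l *: n).
Proof. by move=> Ll Nn T _; apply. Qed.

Lemma scale_linear V (n : V) :
  exists f : {linear R^o -> V}, forall a : R, f a = a *: n.
Proof. by apply: mk_linear => a x y; rewrite scalerDl scalerA. Qed.

(** [N] is a submodule that is minimal among those that are not finitely
    generated; the section shows that it cannot exist. *)
Section Hopkins.
Variables (V : lmodType R) (N : V -> Prop).
Hypotheses (hN : submodP N) (nfg : ~ fg N).
Hypothesis Nmin : forall B, submodP B -> (forall x, B x -> N x) ->
  fg B \/ (forall x, N x -> B x).

(** Proper submodules of [N] are finitely generated, so two of them cannot add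
    up to [N]. *)
Lemma hollow B C : submodP B -> submodP C ->
  (forall x, B x -> N x) -> (forall x, C x -> N x) ->
  (forall x, N x -> sumS B C x) ->
  (forall x, N x -> B x) \/ (forall x, N x -> C x).
Proof.
move=> hB hC BN CN NBC.
have [fB|] := Nmin hB BN; last by left.
have [fC|] := Nmin hC CN; last by right.
case: nfg; apply: fg_ext (fg_sum fB fC) => x; split=> [|/NBC//].
by move=> [b [c [/BN Nb /CN Nc ->]]]; apply: submodD.
Qed.

Let Ann (a : R^o) : Prop := forall n, N n -> (a : R) *: n = 0.

Lemma ann_submod : submodP Ann.
Proof.
split=> [n|a x y Ax Ay n Nn]; first by rewrite scale0r.
by rewrite scalerDl -scalerA Ax // Ay // scaler0 addr0.
Qed.

Lemma ann_finite : exists s : seq V, (forall n, n \in s -> N n) /\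
  forall a : R, (forall n, n \in s -> a *: n = 0) -> Ann a.
Proof.
pose F (I : R^o -> Prop) := exists s : seq V, (forall n, n \in s -> N n) /\
  I = fun a : R^o => forall n, n \in s -> (a : R) *: n = 0.
have [I [s [sN ->]]||I [[s [sN IE]] Imin]] :=
  @artin_min R^o (fun _ => True) F (@artin_ring _).
- split=> //; split=> [n _|a x y hx hy n ns]; first by rewrite scale0r.
  by rewrite scalerDl -scalerA hx // hy // scaler0 addr0.
- by exists (fun a : R^o => forall n : V, n \in [::] -> (a : R) *: n = 0), [::].
exists s; split=> // a sa n Nn.
have := Imin (fun a : R^o => forall k, k \in n :: s -> (a : R) *: k = 0).
rewrite IE; apply=> //; last exact: mem_head.
  exists (n :: s); split=> // k; rewrite in_cons => /orP[/eqP -> //|].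
  exact: sN.
by move=> x hx k ks; apply: hx; rewrite in_cons ks orbT.
Qed.

(** Applied to the list of [ann_finite], this makes every left ideal finitely
    generated modulo the annihilator of [N]: the ring modulo that annihilator
    embeds into a finite product of cyclic submodules of [N], and these are
    noetherian because they are proper. *)
Lemma ideal_fg_mod (s : seq V) (L : R^o -> Prop) : submodP L ->
  (forall n, n \in s -> N n) ->
  exists t : seq R^o, (forall l, l \in t -> L l) /\
    forall x, L x -> exists y, lspan t y /\
      forall n, n \in s -> ((x - y : R^o) : R) *: n = 0.
Proof.
elim: s L => [|n s IH] L hL sN.
  by exists [::]; split=> // x _; exists 0.
have Nn : N n by apply: sN; rewrite mem_head.
have [f fE] := scale_linear n.
pose Ln x := exists2 l, L l & f l = x.
have hLn : submodP Ln.
  case: hL => L0 hL; split; first by exists 0 => //; rewrite linear0.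
  move=> a x y [l Ll <-] [m Lm <-]; exists (a *: l + m); last by rewrite linearP.
  exact: hL.
have LnN x : Ln x -> N x by move=> [l _ <-]; rewrite fE; apply: submodZ.
have [g hg] : fg Ln.
  have [//|NL] := Nmin hLn LnN; case: nfg.
  apply: fg_ext (fg_cyc n) => x; split; first by move=> [a ->]; apply: submodZ.
  by move=> /NL[l _ <-]; exists l; rewrite fE.
have [t1 [t1L t1g]] : exists t, (forall l, l \in t -> L l) /\ map f t = g.
  by apply: preimage_seq => x /mem_lspan/hg.
pose L' (a : R^o) := L a /\ f a = 0.
have hL' : submodP L'.
  case: hL => L0 hL; split; first by split=> //; rewrite linear0.
  move=> a x y [Lx fx] [Ly fy]; split; first exact: hL.
  by rewrite linearP fx fy scaler0 addr0.
have [|t2 [t2L ht2]] := IH L' hL'.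
  by move=> k ks; apply: sN; rewrite in_cons ks orbT.
exists (t1 ++ t2); split.
  by move=> l; rewrite mem_cat => /orP[/t1L//|/t2L[]].
move=> x Lx.
have : lspan g (f x) by apply/hg; exists x.
rewrite -t1g => /lspan_map[y1 [sy1 fy1]].
have Ly1 : L y1 by apply: lspan_min sy1.
have L'x : L' (x - y1).
  by split; [apply: submodB|rewrite linearB fy1 subrr].
have [y2 [sy2 hy2]] := ht2 _ L'x.
have [_ fy2] : L' y2 by apply: lspan_min sy2 => //.
exists (y1 + y2); split.
  apply: submodD (lspan_submod _) _ _ _ _.
    apply: lspan_min sy1 => [|l lt]; first exact: lspan_submod.
    by apply: mem_lspan; rewrite mem_cat lt.
  apply: lspan_min sy2 => [|l lt]; first exact: lspan_submod.
  by apply: mem_lspan; rewrite mem_cat lt orbT.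
move=> k; rewrite in_cons opprD addrA => /orP[/eqP ->|]; last exact: hy2.
by rewrite -fE linearB /= linearB /= fy1 fy2 subrr subr0.
Qed.

Lemma prod_sub (L : R^o -> Prop) : forall x, prodS L N x -> N x.
Proof. by move=> x; apply=> // l n _ Nn; apply: submodZ. Qed.

(** Take a left ideal [L] minimal with [L N = N].  It inherits from [N] that it
    is not the sum of two proper parts, so it is generated by one [l] modulo the
    annihilator, and it has a largest proper part [L0].  Then [Z = L0 N] is
    proper, and in [N / Z] each [L n] is zero or simple, so [N / Z] is a sum of
    simple modules.  A complement of one of them contradicts [hollow]. *)
Lemma minimal_non_fg_absurd : False.
Proof.
have hA := ann_submod.
(* Minimality is taken among left ideals with L N = N above the annihilator. *)
pose F (L : R^o -> Prop) :=
  [/\ submodP L, forall a, Ann a -> L a & forall x, N x -> prodS L N x].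
have [L []//||L [[hL AL NLN] Lmin]] :=
  @artin_min R^o (fun _ => True) F (@artin_ring _).
  exists (fun _ => True); split=> // x Nx.
  by rewrite -[x]scale1r; apply: mem_prod.
have Lprop L1 : submodP L1 -> (forall a, Ann a -> L1 a) ->
    (forall x, L1 x -> L x) -> (forall x, N x -> prodS L1 N x) ->
    forall x, L x -> L1 x.
  by move=> h1 AL1 L1L NL1; apply: Lmin.
have Lhollow L1 L2 : submodP L1 -> submodP L2 ->
    (forall a, Ann a -> L1 a) -> (forall a, Ann a -> L2 a) ->
    (forall x, L1 x -> L x) -> (forall x, L2 x -> L x) ->
    (forall x, L x -> sumS L1 L2 x) ->
    (forall x, L x -> L1 x) \/ (forall x, L x -> L2 x).
  move=> h1 h2 AL1 AL2 L1L L2L LL.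
  have [||||x Nx|?|?] := @hollow (prodS L1 N) (prodS L2 N).
  - exact: prod_submod.
  - exact: prod_submod.
  - exact: prod_sub.
  - exact: prod_sub.
  - apply: (NLN x Nx).
      by apply: sum_submod; apply: prod_submod.
    move=> l n /LL[a [b [L1a L2b ->]]] Nn; rewrite scalerDl.
    by exists ((a : R) *: n), ((b : R) *: n); split=> //; apply: mem_prod.
  - by left; apply: Lprop.
  - by right; apply: Lprop.
pose cycA (l : R^o) := sumS (cyc l) Ann.
have hcyc l : submodP (cycA l) by apply: sum_submod => //; apply: cyc_submod.
have Acyc l a : Ann a -> cycA l a by apply: sum_r; apply: cyc_submod.
have lcyc l : cycA l l by apply: sum_l => //; apply: cyc_id.
have cycL l : L l -> forall x, cycA l x -> L x.
  move=> Ll x [b [c [lb Ac ->]]]; apply: submodD => //; last exact: AL.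
  exact: cyc_min lb.
have nLA : ~ (forall x, L x -> Ann x).
  move=> LA; case: nfg; exists [::] => x; split=> [/NLN|-> /=].
    apply; first exact: (@lspan_submod V [::]).
    by move=> l n /LA; apply.
  by case: hN.
have [l [Ll Lcyc]] : exists l, L l /\ forall x, L x -> cycA l x.
  have [s [sN sA]] := ann_finite.
  have [t [tL ht]] := ideal_fg_mod hL sN.
  have : forall x, L x -> sumS (lspan t) Ann x.
    move=> x Lx; have [y [sy hy]] := ht x Lx.
    by exists y, (x - y); split=> //; [apply: sA|rewrite subrKC].
  elim: t tL {ht} => [|g t IH] tL Lt.
    by case: nLA => x /Lt[_ [a [-> Aa ->]]]; rewrite add0r.
  have Lg : L g by apply: tL; rewrite mem_head.
  have tL' k : k \in t -> L k by move=> kt; apply: tL; rewrite in_cons kt orbT.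
  have [||||||x Lx|?|?] := @Lhollow (cycA g) (sumS (lspan t) Ann).
  - exact: hcyc.
  - by apply: sum_submod => //; apply: lspan_submod.
  - exact: Acyc.
  - by move=> a; apply: sum_r; apply: lspan_submod.
  - exact: cycL.
  - move=> x [b [c [lb Ac ->]]]; apply: submodD => //; last exact: AL.
    exact: lspan_min lb.
  - have [_ [a [[c [y [sy ->]] Aa ->]]]] := Lt x Lx.
    exists (c *: g), (y + a); split; last by rewrite addrA.
      by apply: sum_l => //; exists c.
    by exists y, a.
  - by exists g.
  - exact: IH.
(* The elements that do not generate L modulo Ann form a submodule because L
   is not a sum of two proper parts. *)
pose L0 (x : R^o) := L x /\ ~ forall y, L y -> cycA x y.
have AL0 a : Ann a -> L0 a.
  move=> Aa; split; first exact: AL.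
  move=> La; apply: nLA => y /La[b [c [ab Ac ->]]].
  by apply: (submodD hA) => //; apply: cyc_min ab.
have hL0 : submodP L0.
  split=> [|a x y [Lx nx] [Ly ny]]; first by apply: AL0; case: hA.
  split; first by case: hL => _; apply.
  move=> Lxy; have [||||||y' Ly'|//|//] := @Lhollow (cycA x) (cycA y).
  - exact: hcyc.
  - exact: hcyc.
  - exact: Acyc.
  - exact: Acyc.
  - exact: cycL.
  - exact: cycL.
  have [_ [c [[b ->] Ac ->]]] := Lxy y' Ly'.
  exists (b *: (a *: x)), (b *: y + c); split.
  - by apply: sum_l => //; exists (b * a); rewrite scalerA.
  - by exists (b *: y), c; split=> //; exists b.
  - by rewrite scalerDr addrA.
pose Z := prodS L0 N.
have hZ : submodP Z by apply: prod_submod.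
have ZN : forall x, Z x -> N x by apply: prod_sub.
have nNZ : ~ (forall x, N x -> Z x).
  move=> NZ; have /(_ l Ll)[_] := Lprop L0 hL0 AL0 (fun x => @proj1 _ _) NZ.
  by apply.
have lgen T : submodP T -> (forall n, N n -> T ((l : R) *: n)) ->
    forall x, N x -> T x.
  move=> hT lT x /NLN; apply=> // k n /Lcyc[_ [a [[b ->] Aa ->]]] Nn.
  rewrite scalerDl Aa // addr0 -scalerA; apply: submodZ => //; exact: lT.
have [n0 [Nn0 Zn0]] : exists n0, N n0 /\ ~ Z ((l : R) *: n0).
  apply: contrapT => h; apply: nNZ; apply: lgen => // n Nn.
  by apply: contrapT => nZ; apply: h; exists n.
pose v0 := (l : R) *: n0.
have Nv0 : N v0 by apply: submodZ.
(* Zorn: C is a complement of R v0 modulo Z.  The empty set is admitted only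
   because it is the union of the empty chain. *)
pose good (C : V -> Prop) :=
  [/\ submodP C, forall x, Z x -> C x, forall x, C x -> N x & ~ C v0].
have [C [gC Cmax]] : exists C, good C /\ forall D, good D ->
    (forall x, C x -> D x) -> forall x, D x -> C x.
  have [F' F'P tot|C [[->|gC] Cmax]] := @Zorn_bigcup V
      [set C | C = set0 \/ good C]%classic.
  - have [[D FD gD]|nD] := pselect (exists2 D, F' D & good D); last first.
      left; apply/seteqP; split=> // x [D FD Dx].
      by have [D0|gD] := F'P _ FD; [rewrite D0 in Dx|case: nD; exists D].
    have fgood E x : F' E -> E x -> good E.
      by move=> /F'P[-> //|].
    right; split.
    - split; first by exists D => //; have [[]] := gD.
      move=> a x y [E FE Ex] [E' FE' E'y].
      have [[_ hE] _ _ _] := fgood _ _ FE Ex.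
      have [[_ hE'] _ _ _] := fgood _ _ FE' E'y.
      have [EE'|E'E] := tot _ _ FE FE'.
        by exists E' => //; apply: hE' => //; apply: EE'.
      by exists E => //; apply: hE => //; apply: E'E.
    - by move=> x Zx; exists D => //; have [_ h _ _] := gD; apply: h.
    - by move=> x [E FE Ex]; have [_ _ h _] := fgood _ _ FE Ex; apply: h.
    - by move=> [E FE Ex]; have [_ _ _] := fgood _ _ FE Ex; apply.
  - have [] := Cmax Z; last by right; split.
    by split=> // /(_ 0) /(_ (proj1 hZ)).
  exists C; split=> // D gD CD; apply: contrapT => nDC.
  by apply: (Cmax D) => //; right.
have [hC ZC CN nCv0] := gC.
have hCv : submodP (sumS C (cyc v0)).
  by apply: sum_submod => //; apply: cyc_submod.
have [n [Nn nCn]] : exists n, N n /\ ~ sumS C (cyc v0) ((l : R) *: n).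
  apply: contrapT => h.
  have [|||||NC|Nc] := @hollow C (cyc v0) => //.
  - exact: cyc_submod.
  - by move=> x; apply: cyc_min.
  - apply: lgen => // n Nn; apply: contrapT => nC; apply: h.
    by exists n.
  - by apply: nCv0; apply: NC.
  - case: nfg; apply: fg_ext (fg_cyc v0) => x; split=> [|/Nc//].
    exact: cyc_min.
pose Ln y := exists2 x : R^o, L x & y = (x : R) *: n.
have hLn : submodP Ln.
  case: (hL) => L0' hl; split; first by exists 0; rewrite ?scale0r.
  move=> a x y [b Lb ->] [c Lc ->]; exists (a *: b + c); first exact: hl.
  by rewrite scalerDl scalerA.
(* By maximality of C, adding L n to C captures v0; the coefficient x of v0 in
   L n generates L modulo Ann, and that puts l n into C + R v0. *)
have [v0C'|nv0C'] := pselect (sumS C Ln v0); last first.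
  apply: nCn; apply: sum_l; first exact: cyc_submod.
  apply: (Cmax (sumS C Ln)).
  - split=> //; first exact: sum_submod.
      by move=> x /ZC; apply: sum_l.
    move=> x [c [_ [Cc [b _ ->] ->]]]; apply: submodD => //; first exact: CN.
    exact: submodZ.
  - by move=> x; apply: sum_l.
  - by apply: sum_r => //; exists l.
have [c [_ [Cc [x Lx ->] v0E]]] := v0C'.
have [L0x|nL0x] := pselect (L0 x).
  apply: nCv0; rewrite v0E; apply: submodD => //; apply: ZC.
  exact: mem_prod.
have Lxc : forall y, L y -> cycA x y.
  by apply: contrapT => h; apply: nL0x.
have [_ [b [[a ->] Ab lE]]] := Lxc l Ll.
apply: nCn; rewrite lE scalerDl Ab // addr0 -scalerA.
have -> : (x : R) *: n = v0 - c by rewrite v0E addrC addKr.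
rewrite scalerBr addrC; exists (- (a *: c)), (a *: v0); split=> //.
  by apply: submodN => //; apply: submodZ.
by exists a.
Qed.

End Hopkins.

(** The theorem of Hopkins, for modules. *)
Lemma artin_fg V (S : V -> Prop) : artin S -> submodP S -> fg S.
Proof.
move=> aS hS; apply: contrapT => nS.
have [A []//||N [[hN NS nN] Nmin]] := @artin_min V S
  (fun A => [/\ submodP A, forall x, A x -> S x & ~ fg A]) aS.
  by exists S.
apply: (@minimal_non_fg_absurd V N) => // B hB BN.
have [?|nB] := pselect (fg B); first by left.
by right; apply: Nmin => //; split=> // x /BN/NS.
Qed.

End Spans.

(** * Short exact sequences and projective modules *)

Section Sequences.
Variable R : pzRingType.
Implicit Types A B E K M N P Q V X Y Z : lmodType R.

Definition ses K E X (i : {linear K -> E}) (q : {linear E -> X}) : Prop :=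
  [/\ injective i, exact_at i q & surj q].

Lemma pair_lin A B a (x x' : A) (y y' : B) :
  a *: ((x, y) : (A * B)%type) + (x', y') = (a *: x + x', a *: y + y').
Proof. by []. Qed.

Lemma ses0 K E X (i : {linear K -> E}) (q : {linear E -> X}) x :
  ses i q -> q (i x) = 0.
Proof. by case=> _ ex _; apply/ex; exists x. Qed.

Lemma ker_submod A B (f : {linear A -> B}) : submodP (fun x => f x = 0).
Proof.
split=> [|a x y fx fy]; first by rewrite linear0.
by rewrite linearP fx fy scaler0 addr0.
Qed.

Lemma im_submod A B (f : {linear A -> B}) : submodP (fun y => exists x, f x = y).
Proof.
split=> [|a _ _ [x <-] [y <-]]; first by exists 0; rewrite linear0.
by exists (a *: x + y); rewrite linearP.
Qed.

Lemma kernel_ses E X (q : {linear E -> X}) : surj q ->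
  exists K (i : {linear K -> E}), ses i q.
Proof.
move=> qs; have [K [i [ii iE]]] := sub_lmod (ker_submod q).
by exists K, i; split.
Qed.

Lemma kernel_uniq K K' E X (i : {linear K -> E}) (i' : {linear K' -> E})
    (q : {linear E -> X}) :
  injective i -> injective i' -> exact_at i q -> exact_at i' q -> iso K K'.
Proof.
move=> ii ii' ei ei'.
have [|u uE] := linear_lift (t := i) ii'.
  by move=> x; apply/ei'/ei; exists x.
apply: (@iso_of_bij _ _ _ u); first by move=> x y e; apply: ii; rewrite -!uE e.
move=> y; have [x xE] : exists x, i x = i' y by apply/ei/ei'; exists y.
by exists x; apply: ii'; rewrite uE.
Qed.

Lemma ses_isol K K' E X (i : {linear K -> E}) (q : {linear E -> X})
    (f : {linear K' -> K}) (g : {linear K -> K'}) :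
  cancel f g -> cancel g f -> ses i q -> ses (i \o f : {linear K' -> E}) q.
Proof.
move=> fg gf [ii ei qs]; split=> //; first by move=> x y /= /ii /(can_inj fg).
move=> y; split=> [/ei[x <-]|[x <-] /=]; first by exists (g x); rewrite /= gf.
by apply/ei; exists (f x).
Qed.

Lemma ses_isor K E X X' (i : {linear K -> E}) (q : {linear E -> X})
    (f : {linear X -> X'}) (g : {linear X' -> X}) :
  cancel f g -> cancel g f -> ses i q -> ses i (f \o q : {linear E -> X'}).
Proof.
move=> fg gf [ii ei qs]; split=> //.
  move=> y /=; split=> [h|/ei ->]; last by rewrite linear0.
  by apply/ei; rewrite -[q y]fg h linear0.
by move=> y; have [x qx] := qs (g y); exists x; rewrite /= qx gf.
Qed.

Lemma ses_prodr K E X Q (i : {linear K -> E}) (q : {linear E -> X}) :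
  ses i q -> exists (i' : {linear K -> (E * Q)%type})
                    (q' : {linear (E * Q)%type -> (X * Q)%type}),
    [/\ ses i' q', forall x, i' x = (i x, 0) & forall x, q' x = (q x.1, x.2)].
Proof.
move=> [ii ei qs].
have [|i' iE] := @mk_linear _ _ (E * Q)%type (fun x => (i x, 0)).
  by move=> a x y; rewrite linearP pair_lin scaler0 addr0.
have [q' qE] := prod_functor q (idfun : {linear Q -> Q}).
exists i', q'; split=> //; split.
- by move=> x y; rewrite !iE => -[/ii].
- move=> [y z]; rewrite qE /=; split=> [[/ei[x <-] ->]|[x]].
    by exists x; rewrite iE.
  by rewrite iE => -[<- <-]; congr (_, _); apply/ei; exists x.
- by move=> [y z]; have [x <-] := qs y; exists (x, z); rewrite qE.
Qed.

Lemma ses_prodl K E X Q (i : {linear K -> E}) (q : {linear E -> X}) :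
  ses i q -> exists (i' : {linear (K * Q)%type -> (E * Q)%type})
                    (q' : {linear (E * Q)%type -> X}),
    [/\ ses i' q', forall x, i' x = (i x.1, x.2) & forall x, q' x = q x.1].
Proof.
move=> [ii ei qs].
have [i' iE] := prod_functor i (idfun : {linear Q -> Q}).
exists i', (q \o fst : {linear (E * Q)%type -> X}); split=> //; split.
- by move=> [x z] [x' z']; rewrite !iE /= => -[/ii -> ->].
- move=> [y z] /=; split=> [/ei[x <-]|[[x z']]].
    by exists (x, z); rewrite iE.
  by rewrite iE /= => -[<- _]; apply/ei; exists x.
- by move=> y; have [x <-] := qs y; exists (x, 0).
Qed.

Lemma proj_retract A P (s : {linear A -> P}) (t : {linear P -> A}) :
  cancel s t -> projective P -> projective A.
Proof.
move=> st pP X Y g f gs; have [h hE] := pP X Y g (f \o t : {linear P -> Y}) gs.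
by exists (h \o s : {linear A -> X}) => x /=; rewrite hE /= st.
Qed.

Lemma proj_prod P Q : projective P -> projective Q -> projective (P * Q)%type.
Proof.
move=> pP pQ X Y g f gs.
have [|l lE] := @mk_linear _ P (P * Q)%type (fun x => (x, 0)).
  by move=> a x y; rewrite pair_lin scaler0 addr0.
have [|r rE] := @mk_linear _ Q (P * Q)%type (fun x => (0, x)).
  by move=> a x y; rewrite pair_lin scaler0 addr0.
have [h1 h1E] := pP X Y g (f \o l : {linear P -> Y}) gs.
have [h2 h2E] := pQ X Y g (f \o r : {linear Q -> Y}) gs.
have [h hE] := coprod_map h1 h2; exists h => x.
rewrite hE linearD h1E h2E /= -linearD lE rE; congr (f _).
by case: x => x y; rewrite -[(x, 0)]scale1r pair_lin !scale1r addr0 add0r.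
Qed.

Definition zero_lmod : lmodType R := 'rV[R]_0.

Lemma zero_lmodE (x : zero_lmod) : x = 0.
Proof. exact: thinmx0. Qed.

Lemma proj_free k : projective ('rV[R]_k : lmodType R).
Proof.
move=> A B g f gs.
pose a i := projT1 (cid (gs (f (delta_mx 0 i)))).
have aE i : g (a i) = f (delta_mx 0 i) by rewrite /a; case: cid.
have [|h hE] := @mk_linear _ ('rV[R]_k) A (fun x => \sum_i x 0 i *: a i).
  move=> c x y; rewrite scaler_sumr -big_split; apply: eq_bigr => i _ /=.
  by rewrite !mxE scalerDl scalerA.
exists h => x; rewrite hE [in RHS](row_sum_delta x) !linear_sum.
by apply: eq_bigr => i _; rewrite !linearZ aE.
Qed.

Lemma fin_genP M : fin_gen M <-> fg (fun _ : M => True).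
Proof.
split=> [[k [g hg]]|[s hs]].
  exists [seq g i | i <- enum 'I_k] => x; split=> // _.
  have [c ->] := hg x; apply: big_ind => [|y z|i _].
  - by case: (lspan_submod [seq g i | i <- enum 'I_k]).
  - exact: submodD (lspan_submod _) _ _.
  by apply: submodZ (lspan_submod _) _ _ _; apply/mem_lspan/map_f; rewrite mem_enum.
exists (size s), (fun i => nth 0 s i) => x.
have /(hs x) : True by [].
elim: s {hs} x => [|g s IH] x /=.
  by move=> ->; exists (fun _ => 0); rewrite big_ord0.
move=> [a [y [/IH[c ->] ->]]].
exists (fun i => oapp c a (unlift ord0 i)); rewrite big_ord_recl /= unlift_none.
by congr (_ + _); apply: eq_bigr => i _; rewrite liftK.
Qed.

Lemma fin_gen_surj M N (f : {linear M -> N}) : surj f -> fin_gen M -> fin_gen N.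
Proof.
move=> fs /fin_genP[s hs]; apply/fin_genP; exists (map f s) => y; split=> // _.
by have [x <-] := fs y; apply/map_lspan/hs.
Qed.

Lemma fin_gen_iso M N : iso M N -> fin_gen M -> fin_gen N.
Proof.
by move=> /iso_inv[f [g [_ gf]]]; apply: (@fin_gen_surj _ _ f) => y; exists (g y).
Qed.

Lemma fin_gen_fst X Y : fin_gen (X * Y)%type -> fin_gen X.
Proof.
apply: (@fin_gen_surj _ _ (fst : {linear (X * Y)%type -> X})) => x.
by exists (x, 0).
Qed.

Lemma fin_gen_snd X Y : fin_gen (X * Y)%type -> fin_gen Y.
Proof.
apply: (@fin_gen_surj _ _ (snd : {linear (X * Y)%type -> Y})) => x.
by exists (0, x).
Qed.

Lemma free_cover M : fin_gen M ->
  exists P (f : {linear P -> M}), [/\ projective P, fin_gen P & surj f].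
Proof.
move=> [k [g hg]].
have [|f fE] := @mk_linear _ ('rV[R]_k) M (fun x => \sum_i x 0 i *: g i).
  move=> c x y; rewrite scaler_sumr -big_split; apply: eq_bigr => i _ /=.
  by rewrite !mxE scalerDl scalerA.
exists 'rV[R]_k, f; split; first exact: proj_free.
  exists k, (fun i => delta_mx 0 i) => x; exists (fun i => x 0 i).
  exact: row_sum_delta.
move=> x; have [c ->] := hg x; exists (\row_i c i); rewrite fE.
by apply: eq_bigr => i _; rewrite mxE.
Qed.

Fixpoint lin_iter V (u : {linear V -> V}) k : {linear V -> V} :=
  if k is k'.+1 then (u \o lin_iter u k' : {linear V -> V}) else idfun.

Lemma lin_iterD V (u : {linear V -> V}) k l x :
  lin_iter u (k + l) x = lin_iter u k (lin_iter u l x).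
Proof. by elim: k => //= k ->. Qed.

End Sequences.

(** * Chain conditions and projective covers over a left artinian ring *)

Section Artinian.
Variable R : pzRingType.
Hypothesis hR : left_artinian R.
Implicit Types A B E K M P Q V X Y Z : lmodType R.

Lemma artin_fin_gen M : fin_gen M -> artin (fun _ : M => True).
Proof.
by move=> /fin_genP[s hs]; apply: artin_sub (artin_lspan hR (s := s)) _ => x /hs.
Qed.

Lemma fg_submod M (S : M -> Prop) : fin_gen M -> submodP S -> fg S.
Proof. by move=> /artin_fin_gen aM; apply/artin_fg/(artin_sub aM). Qed.

Lemma fin_gen_sub K M (i : {linear K -> M}) :
  injective i -> fin_gen M -> fin_gen K.
Proof.
move=> ii gM; have [s hs] := fg_submod gM (im_submod i).
have [|t [_ tE]] := @preimage_seq _ _ (fun _ => True) i s.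
  by move=> g /mem_lspan/hs[x <-]; exists x.
apply/fin_genP; exists t => x; split=> // _.
have : lspan s (i x) by apply/hs; exists x.
by rewrite -tE => /lspan_map[y [sy /ii <-]].
Qed.

Lemma ascending_stable M (I : nat -> M -> Prop) : fin_gen M ->
  (forall k, submodP (I k)) -> (forall k x, I k x -> I k.+1 x) ->
  exists N, forall k x, I k x -> I N x.
Proof.
move=> gM hI inc.
have le m k x : (m <= k)%N -> I m x -> I k x.
  move=> /subnKC <- Im; elim: (k - m)%N => [|j IH]; first by rewrite addn0.
  by rewrite addnS; apply: inc.
have [|s hs] := fg_submod (S := fun x => exists k, I k x) gM.
  split; first by exists 0; case: (hI 0).
  move=> a x y [k Ik] [l Il]; exists (maxn k l); have [_ h] := hI (maxn k l).
  by apply: h; [apply: le Ik; apply: leq_maxl|apply: le Il; apply: leq_maxr].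
have [N hN] : exists N, forall g, g \in s -> I N g.
  have : forall g, g \in s -> exists k, I k g by move=> g /mem_lspan/hs.
  elim: s {hs} => [|g s IH] h; first by exists 0.
  have [|N hN] := IH; first by move=> k ks; apply: h; rewrite in_cons ks orbT.
  have [k hk] := h g (mem_head _ _); exists (maxn k N) => x.
  rewrite in_cons => /orP[/eqP ->|/hN]; first by apply: le hk; apply: leq_maxl.
  by apply: le; apply: leq_maxr.
by exists N => k x Ik; apply: (lspan_min (hI N) hN); apply/hs; exists k.
Qed.

(** The kernels of the powers of [u] form an ascending chain. *)
Lemma surj_endo_inj M (u : {linear M -> M}) : fin_gen M -> surj u -> injective u.
Proof.
move=> gM us; apply: linear_inj.
have [k|k x /= ->|N hN] := ascending_stable
    (I := fun k x => lin_iter u k x = 0) gM.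
- exact: ker_submod.
- exact: linear0.
have sN k : surj (lin_iter u k).
  elim: k => [|k IH] y; first by exists y.
  by have [z <-] := us y; have [x <-] := IH z; exists x.
move=> x ux; have [y yx] := sN N x.
by rewrite -yx; apply: (hN N.+1); rewrite /= yx.
Qed.

(** Fitting's lemma: the image and the kernel of a high power no longer change.
    The exponent is positive, so that a factorization of [u] through another
    module gives one of its power. *)
Lemma fitting M (u : {linear M -> M}) : fin_gen M ->
  exists k, let v := lin_iter u k.+1 in
    (forall x, exists y, v x = v (v (v y))) /\
    (forall x, v (v (v x)) = 0 -> v x = 0).
Proof.
move=> gM.
have [k|k x /= ->|N1 hN1] := ascending_stable
    (I := fun k x => lin_iter u k x = 0) gM.
- exact: ker_submod.
- exact: linear0.
have [k|//|k x [y <-]|N2 hN2] := artin_fin_gen gM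
    (I := fun k x => exists y, lin_iter u k y = x).
- exact: im_submod.
- by exists (u y); rewrite -addn1 lin_iterD.
exists (maxn N1 N2); set m := maxn N1 N2; split=> x.
  have [||y <-] := hN2 (m.+1 + (m.+1 + m.+1))%N _ (lin_iter u m.+1 x).
  - by apply: leq_trans (leq_addr _ _); apply/leqW/leq_maxr.
  - have /subnKC <- : (N2 <= m.+1)%N by apply/leqW/leq_maxr.
    by exists (lin_iter u (m.+1 - N2) x); rewrite -lin_iterD.
  by exists y; rewrite !lin_iterD.
rewrite -!lin_iterD => /hN1 h.
have /subnK <- : (N1 <= m.+1)%N by apply/leqW/leq_maxl.
by rewrite lin_iterD h linear0.
Qed.

(** Start from a free module [P -> M] and a submodule [S] of [P] minimal among
    those that still map onto [M].  A lift [h : P -> S] restricts to a surjective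
    endomorphism of [S] by minimality.  That endomorphism is bijective, hence
    [S] is a direct summand of [P]. *)
Lemma cover_exists M : fin_gen M ->
  exists P (f : {linear P -> M}), projective_cover f.
Proof.
move=> /free_cover[P [f [pP gP fs]]].
have [|S []//||S [[hS Sf] Smin]] := @artin_min R P (fun _ => True)
    (fun S => submodP S /\ forall p, exists2 s, S s & f s = f p).
- exact: artin_fin_gen.
- by exists (fun _ => True); split=> // p; exists p.
have [K [i [ii iE]]] := sub_lmod hS.
have fis : surj (f \o i).
  move=> y; have [p <-] := fs y; have [s /iE[x <-] <-] := Sf p.
  by exists x.
have [h hE] := pP K M (f \o i : {linear K -> M}) f fis.
pose g : {linear K -> K} := h \o i.
have gs : surj g.
  move=> y; have [|||x /ii <-] := Smin (fun x => exists z, i (g z) = x) _ _ (i y).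
  - split; first exact: (im_submod (i \o g : {linear K -> P})).
    move=> p; have [s /iE[x <-] <-] := Sf p.
    by exists (i (g x)); [exists x|exact: hE].
  - by move=> x [z <-]; apply/iE; exists (g z).
  - by apply/iE; exists y.
  - by exists x.
have gi := surj_endo_inj (fin_gen_sub ii gP) gs.
have [g' [gg' g'g]] := linear_inverse gi gs.
exists K, (f \o i : {linear K -> M}); split=> //.
  apply: (@proj_retract _ _ P (i \o g' : {linear K -> P}) h) pP => x.
  exact: g'g.
move=> T /closed_submodP hT TK x.
have [|||y [yT /ii <-] //] := Smin (fun y => exists z, z \in T /\ i z = y) _ _ (i x).
- split.
    have [T0 hT'] := hT; split; first by exists 0; rewrite linear0.
    move=> a _ _ [y [Ty <-]] [z [Tz <-]]; exists (a *: y + z).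
    by rewrite linearP; split=> //; apply: hT'.
  move=> p; have [s /iE[z <-] <-] := Sf p; have [y [w [Ty fw ->]]] := TK z.
  exists (i y); first by exists y.
  by rewrite linearD linearD /= [f (i w)]fw addr0.
- by move=> y [z [_ <-]]; apply/iE; exists z.
- by apply/iE; exists x.
Qed.

(** Lifts of generators of [M] span [P] modulo the superfluous kernel. *)
Lemma cover_fin_gen P M (f : {linear P -> M}) :
  projective_cover f -> fin_gen M -> fin_gen P.
Proof.
move=> [_ fs sup] /fin_genP[s hs]; apply/fin_genP.
have [|t [_ tE]] := @preimage_seq _ _ (fun _ => True) f s.
  by move=> g _; have [x <-] := fs g; exists x.
exists t => x; split=> // _; apply/asboolP.
apply: (sup _ (submodP_closed (lspan_submod t))) => y.
have : lspan s (f y) by apply/hs.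
rewrite -tE => /lspan_map[z [sz fz]]; exists z, (y - z); split.
- by apply/asboolP.
- by rewrite linearB fz subrr.
- by rewrite addrC subrK.
Qed.

(** Existence of covers shows that the default value of [syzygy] is not used on
    finitely generated modules. *)
Lemma syzygyP M : fin_gen M -> is_syzygy M (syzygy M).
Proof.
move=> gM; rewrite /syzygy; case: pselect => [h|[]]; first by case: cid.
have [P [f cf]] := cover_exists gM; have [_ fs _] := cf.
by have [K [i [ii ei _]]] := kernel_ses fs; exists K, P, f, i.
Qed.

Lemma syzygy_ses M K : is_syzygy M K -> fin_gen M ->
  exists P (f : {linear P -> M}) (i : {linear K -> P}),
    [/\ projective_cover f, fin_gen P & ses i f].
Proof.
move=> [P [f [i [cf ii ei]]]] gM; exists P, f, i; split=> //.
  exact: cover_fin_gen cf gM.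
by split=> //; case: cf.
Qed.

Lemma fin_gen_syzygy M : fin_gen M -> fin_gen (syzygy M).
Proof.
move=> gM; have [P [f [i [_ gP [ii _ _]]]]] := syzygy_ses (syzygyP gM) gM.
exact: fin_gen_sub ii gP.
Qed.

Lemma fin_gen_Omega n M : fin_gen M -> fin_gen (Omega n M).
Proof. by move=> gM; elim: n => //= n; apply: fin_gen_syzygy. Qed.

(** Uniqueness of projective covers: superfluity of the kernels makes the lift
    [h] and then its section surjective. *)
Lemma is_syzygy_iso M M' K K' :
  is_syzygy M K -> is_syzygy M' K' -> iso M M' -> iso K K'.
Proof.
move=> [P [f [i [[pP fs fsup] ii ei]]]] [P' [f' [i' [[pP' fs' fsup'] ii' ei']]]].
move=> /iso_inv[a [b [ab ba]]].
have [h hE] := pP P' M' f' (a \o f : {linear P -> M'}) fs'.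
have hs : surj h.
  move=> y; apply/asboolP.
  apply: (fsup' _ (submodP_closed (im_submod h))) => x.
  have [p pE] := fs (b (f' x)).
  exists (h p), (x - h p); split; last by rewrite addrC subrK.
    by apply/asboolP; exists p.
  by rewrite linearB hE /= pE ba subrr.
have [s sE] := pP' P P' h (idfun : {linear P' -> P'}) hs.
have ss : surj s.
  move=> y; apply/asboolP.
  apply: (fsup _ (submodP_closed (im_submod s))) => x.
  exists (s (h x)), (x - s (h x)); split; last by rewrite addrC subrK.
    by apply/asboolP; exists (h x).
  have fE z : f (s z) = b (f' z) by rewrite -{2}[z]sE hE /= ab.
  by rewrite linearB fE hE /= ab subrr.
have hi : injective h.
  by move=> x y; have [z <-] := ss x; have [w <-] := ss y; rewrite !sE => /= ->.
have ehi : exact_at (h \o i : {linear K -> P'}) f'.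
  have hE' x : f' (h x) = a (f x) by exact: hE.
  move=> y; split=> [|[x <-]] /=; last first.
    by rewrite hE' (proj2 (ei (i x))) ?linear0 //; exists x.
  have [x <-] := hs y; rewrite hE' => /(congr1 b); rewrite ab linear0 => /ei[z <-].
  by exists z.
by apply: (kernel_uniq (q := f') _ ii' ehi ei') => x y /hi/ii.
Qed.

Lemma is_syzygy_prod X Q K :
  is_syzygy X K -> projective Q -> is_syzygy (X * Q)%type K.
Proof.
move=> [P [f [i [[pP fs fsup] ii ei]]]] pQ.
have [i' [f' [[ii' ei' fs'] iE fE]]] := @ses_prodr _ _ _ _ Q _ _ (And3 ii ei fs).
exists (P * Q)%type, f', i'; split=> //; split=> //; first exact: proj_prod.
move=> S /closed_submodP hS sup.
have S0 p : (p, 0) \in S.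
  apply/asboolP.
  apply: (fsup [pred p | `[< (p, 0 : Q) \in S >]]) => [|x].
    apply: submodP_closed; have [S0 hS'] := hS; split=> // a x y Sx Sy.
    have := hS' a _ _ Sx Sy.
    by rewrite pair_lin scaler0 addr0.
  have [[y y'] [[z z'] [Sy + ]]] := sup (x, 0).
  rewrite fE => -[/= fz -> []] -> y'0; exists y, z; split=> //; apply/asboolP.
  by move: y'0; rewrite addr0 => ->.
move=> [p q]; have [[y y'] [[z z'] [Sy + ]]] := sup (p, q).
rewrite fE => -[/= fz ->] [-> ->].
by apply: (submodD hS Sy (x := (y, y')) (y := (z, 0))).
Qed.

Lemma syzygy_iso M N : fin_gen M -> iso M N -> iso (syzygy M) (syzygy N).
Proof.
move=> gM iMN; apply: (is_syzygy_iso (syzygyP gM) (syzygyP _) iMN).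
exact: fin_gen_iso iMN gM.
Qed.

Lemma Omega_iso k M N : fin_gen M -> iso M N -> iso (Omega k M) (Omega k N).
Proof.
move=> gM iMN; elim: k => //= k; apply: syzygy_iso.
exact: fin_gen_Omega.
Qed.

End Artinian.

(** * Modules without projective summands *)

Section Summands.
Variable R : pzRingType.
Implicit Types A B E K M N P Q V X Y Z : lmodType R.

Lemma idempotent_split V (e : {linear V -> V}) : (forall x, e (e x) = e x) ->
  exists A B (iA : {linear A -> V}) (iB : {linear B -> V})
         (h : {linear (A * B)%type -> V}),
    [/\ injective iA /\ injective iB,
        (forall y, (exists x, iA x = y) <-> exists x, e x = y),
        (forall y, (exists x, iB x = y) <-> e y = 0),
        (forall x, h x = iA x.1 + iB x.2) & injective h /\ surj h].
Proof.
move=> ee.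
have [A [iA [iiA hA]]] := sub_lmod (im_submod e).
have [B [iB [iiB hB]]] := sub_lmod (ker_submod e).
have [h hE] := coprod_map iA iB.
have eB b : e (iB b) = 0 by apply/hB; exists b.
have eA a : e (iA a) = iA a.
  by have [|x <-] := proj2 (hA (iA a)); [exists a|rewrite ee].
exists A, B, iA, iB, h; split=> //.
- by move=> y; split=> [/hA|/hA].
- by move=> y; split=> [/hB|/hB].
split; last first.
  move=> x; have [|a aE] := proj1 (hA (e x)); first by exists x.
  have [|b bE] := proj1 (hB (x - e x)); first by rewrite linearB ee subrr.
  by exists (a, b); rewrite hE aE bE addrC subrK.
apply: linear_inj => -[a b]; rewrite hE /= => ab0.
have a0 : iA a = 0.
  by rewrite -(linear0 e) -ab0 linearD eA eB addr0.
move: ab0; rewrite a0 add0r -(linear0 iB) => /iiB ->.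
by move: a0; rewrite -(linear0 iA) => /iiA ->.
Qed.

(** The image of an idempotent that factors through a projective module is
    itself a projective summand. *)
Lemma idempotent_through_proj X P (s : {linear X -> P}) (t : {linear P -> X}) :
  projective P -> no_proj_summand X ->
  (forall x, t (s (t (s x))) = t (s x)) -> forall x, t (s x) = 0.
Proof.
move=> pP nX ee x.
have [A [B [iA [iB [h [[iiA _] hA _ _ [hi hs]]]]]]] :=
  @idempotent_split X (t \o s) ee.
have [|u uE] := linear_lift (t := (t \o s) \o t) iiA.
  by move=> y; apply/hA; exists (t y).
have pA : projective A.
  apply: (@proj_retract _ _ P (s \o iA) u) pP => a.
  have [|y yE] := proj1 (hA (iA a)); first by exists a.
  by apply: iiA; rewrite uE /= -yE /= !ee.
have [|a aE] := proj2 (hA (t (s x))); first by exists x.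
by rewrite -aE (nX A B pA (iso_sym (iso_of_bij hi hs)) a) linear0.
Qed.

Lemma no_proj_summand_iso X Y : iso X Y -> no_proj_summand X -> no_proj_summand Y.
Proof.
by move=> iXY nX P Z pP iY; apply: (nX P Z pP); apply: iso_trans iXY iY.
Qed.

Hypothesis hR : left_artinian R.

(** The reason why stable isomorphisms lift to isomorphisms.  The Fitting
    idempotent of such an endomorphism [t \o s] also factors through the
    projective, hence vanishes, so [t \o s] is nilpotent. *)
Lemma nilpotent_through_proj X P (s : {linear X -> P}) (t : {linear P -> X}) :
  fin_gen X -> projective P -> no_proj_summand X ->
  exists k, forall x, lin_iter (t \o s) k x = 0.
Proof.
move=> gX pP nX; pose u : {linear X -> X} := t \o s.
have [k [im3 ker3]] := fitting hR u gX.
set v := lin_iter u k.+1 in im3 ker3.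
(* [w] inverts [v] on its stable image and kills the Fitting null component *)
have [x|y [[z ->] vvz]|a x y x' y' [[z ->] h] [[z' ->] h']|w wE] :=
    @linear_of_graph R X X (fun x y => (exists z, y = v z) /\ v (v y) = v x).
- by have [y vx] := im3 x; exists (v y); split=> //; exists y.
- by apply: ker3; rewrite vvz linear0.
- by split; [exists (a *: z + z')|]; rewrite !linearP ?h ?h'.
have wuniq x y : (exists z, y = v z) -> v (v y) = v x -> w x = y.
  move=> [z ->] vvz; have [[z' wz] vvw] := wE x.
  apply/eqP; rewrite wz -subr_eq0 -linearB; apply/eqP/ker3.
  by rewrite !linearB -wz vvw vvz subrr.
have vuk x : v x = t (s (lin_iter u k x)) by [].
have idem x : v (w (v (w x))) = v (w x).
  have [[z wz] vvw] := wE x.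
  by rewrite (wuniq (v (w x)) (w x)) //; exists z.
have e0 := @idempotent_through_proj X P
  (s \o (lin_iter u k \o w)) t pP nX idem.
exists k.+1 => x; have [_ <-] := wE x.
by rewrite [v (w x)]e0 linear0.
Qed.

Lemma one_minus_through_proj X P (s : {linear X -> P}) (t : {linear P -> X})
    (w : {linear X -> X}) :
  fin_gen X -> projective P -> no_proj_summand X ->
  (forall x, t (s x) = x - w x) -> injective w /\ surj w.
Proof.
move=> gX pP nX tsE; have [k hk] := nilpotent_through_proj s t gX pP nX.
split.
  apply: linear_inj => x wx0; rewrite -[RHS](hk x).
  by elim: k {hk} => //= k <-; rewrite tsE wx0 subr0.
move=> y; suff [x xE] : exists x, w x = y - lin_iter (t \o s) k y.
  by exists x; rewrite xE hk subr0.
elim: k {hk} => [|k [x xE]] /=; first by exists 0; rewrite linear0 subrr.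
exists (x + lin_iter (t \o s) k y).
by rewrite linearD xE tsE opprB -addrA [- _ + _]addrC.
Qed.

(** Among the idempotents [e] such that [1 - e] factors through a projective,
    choose one with minimal image; a projective summand of that image could be
    split off to make the image smaller. *)
Lemma split_proj_summand M : fin_gen M ->
  exists X Q, [/\ iso M (X * Q)%type, no_proj_summand X & projective Q].
Proof.
move=> gM.
pose F (S : M -> Prop) := exists (e : {linear M -> M}) P
    (s : {linear M -> P}) (t : {linear P -> M}),
  [/\ projective P, forall x, e (e x) = e x, forall x, t (s x) = x - e x
    & S = fun y => exists x, e x = y].
have [|S [e [P [s [t [_ _ _ ->]]]]]||S [[e [P [s [t [pP ee tsE SE]]]]] Smin]] :=
    @artin_min R M (fun _ => True) F.
- exact: artin_fin_gen.
- by split=> //; apply: im_submod.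
- exists (fun y => exists x : M, idfun x = y), idfun, (zero_lmod R).
  exists \0, \0; split=> //; last by move=> x /=; rewrite subrr.
  exact: proj_free.
have [X [Q [iX [iQ [h [[iiX iiQ] hX hQ hE [hi hs]]]]]]] := idempotent_split ee.
exists X, Q; split; first exact/iso_sym/(iso_of_bij hi hs).
  move=> P' Y pP' /iso_inv[f [g [fg gf]]] p.
  have [|r rE] := linear_lift (t := e) iiX; first by move=> y; apply/hX; exists y.
  have riX x : r (iX x) = x.
    apply: iiX; rewrite rE; have [|y <-] := proj1 (hX (iX x)); first by exists x.
    exact: ee.
  have [|c cE] := @mk_linear _ X X (fun x => g (0, (f x).2)).
    by move=> a x y; rewrite !linearP -[RHS]linearP pair_lin scaler0 addr0.
  have [|j jE] := @mk_linear _ P' X (fun p => g (p, 0)).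
    by move=> a x y; rewrite -[RHS]linearP pair_lin scaler0 addr0.
  have jcE x : j (f x).1 + c x = x.
    rewrite jE cE -linearD -[RHS]fg; congr (g _); case: (f x) => y z.
    by rewrite -[(y, 0)]scale1r pair_lin !scale1r addr0 add0r.
  have [s' s'E] := prod_map s (fst \o (f \o r) : {linear M -> P'}).
  have [t' t'E] := coprod_map t (iX \o j).
  have [] := Smin (fun y => exists x, (iX \o (c \o r)) x = y) _ _ (iX (j p)).
  - exists (iX \o (c \o r)), (P * P')%type, s', t'; split=> //.
    + exact: proj_prod.
    + by move=> x /=; rewrite riX !cE gf.
    move=> x; rewrite t'E s'E /= tsE -rE.
    by rewrite -{1}[r x]jcE linearD opprD addrA addrAC subrK.
  - by move=> y [x <-]; rewrite SE; apply/hX; exists (c (r x)).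
  - by rewrite SE; apply/hX; exists (j p).
  move=> x /= /iiX; rewrite cE jE => /(congr1 f); rewrite !gf => -[].
  by [].
have [|u uE] := linear_lift (t := t \- (e \o t)) iiQ.
  by move=> y; apply/hQ; rewrite linearB /= ee subrr.
apply: (@proj_retract _ _ P (s \o iQ) u) pP => q.
have eq0 : e (iQ q) = 0 by apply/hQ; exists q.
by apply: iiQ; rewrite uE /= tsE eq0 subr0 eq0 subr0.
Qed.

End Summands.

(** * Extensions by projective modules *)

Section Ext.
Variable R : pzRingType.
Implicit Types A B E F G H K L M N P Q V X Y Z : lmodType R.

(** Vanishing of [Ext^1(X, Q)] for all projective [Q]. *)
Definition ext1 X : Prop :=
  forall Q, projective Q -> forall K E (i : {linear K -> E}) (q : {linear E -> X}),
    ses i q -> forall g : {linear K -> Q},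
    exists h : {linear E -> Q}, forall x, h (i x) = g x.

(** [K] is a first syzygy of [X] for a projective presentation that need not be
    a cover. *)
Definition presents K X : Prop :=
  exists P (i : {linear K -> P}) (q : {linear P -> X}), projective P /\ ses i q.

(** One projective presentation decides about all extensions: it maps to any
    short exact sequence ending in [X], and the middle term of that sequence is
    the resulting pushout. *)
Lemma ext1_of_presentation K P X (i : {linear K -> P}) (q : {linear P -> X}) :
  projective P -> ses i q ->
  (forall Q, projective Q -> forall g : {linear K -> Q},
     exists h : {linear P -> Q}, forall x, h (i x) = g x) -> ext1 X.
Proof.
move=> pP sq ext Q pQ K' E i' q' sq' g; have [ii ei qs] := sq.
have [ii' ei' qs'] := sq'.
have [u uE] := pP E X q' q qs'.
have [|v vE] := linear_lift (t := u \o i) ii'.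
  by move=> x; apply/ei'; rewrite /= uE; apply: ses0 sq.
have [h hE] := ext Q pQ (g \o v).
have [s sE] := coprod_map u i'; have [t tE] := coprod_map h g.
have [||w wE] := @linear_factor _ _ _ _ s t.
- move=> y; have [p pE] := qs (q' y).
  have [|k kE] := proj1 (ei' (y - u p)); first by rewrite linearB uE pE subrr.
  by exists (p, k); rewrite sE /= kE subrKC.
- move=> [p k]; rewrite sE tE /= => upk.
  have [|z zE] := proj1 (ei p).
    by rewrite -uE; have := congr1 q' upk; rewrite linearD (ses0 _ sq') addr0 linear0.
  rewrite -zE hE /= -linearD; have -> : v z + k = 0; last exact: linear0.
  by apply: ii'; rewrite linearD vE /= zE upk linear0.
by exists w => x; have := wE (0, x); rewrite sE tE /= !linear0 !add0r.
Qed.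

Lemma ext1_iso X Y : iso X Y -> ext1 X -> ext1 Y.
Proof.
move=> /iso_inv[f [g [fg gf]]] eX Q pQ K E i q sq.
exact: (eX Q pQ K E i _ (ses_isor gf fg sq)).
Qed.

Lemma ext1_fst X Y : ext1 (X * Y)%type -> ext1 X.
Proof.
move=> eXY Q pQ K E i q /(@ses_prodr _ _ _ _ Y)[i' [q' [sq' iE _]]] g.
have [h hE] := eXY Q pQ _ _ i' q' sq' g.
have [|l lE] := @mk_linear _ E (E * Y)%type (fun x => (x, 0)).
  by move=> a x y; rewrite pair_lin scaler0 addr0.
by exists (h \o l) => x /=; rewrite lE -iE hE.
Qed.

Lemma ext1_prod K X P : presents K X -> ext1 X -> projective P ->
  ext1 (X * P)%type.
Proof.
move=> [F [i [q [pF sq]]]] eX pP.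
have [i' [q' [sq' iE _]]] := @ses_prodr _ _ _ _ P _ _ sq.
apply: (ext1_of_presentation (proj_prod pF pP) sq') => Q pQ g.
have [h hE] := eX Q pQ _ _ i q sq g.
by exists (h \o fst) => x; rewrite /= iE hE.
Qed.

Lemma ses_zero X : exists (i : {linear zero_lmod R -> X}), ses i (@idfun X).
Proof.
exists \0; split=> [x y _|y|y]; last by exists y.
  by rewrite [x]zero_lmodE [y]zero_lmodE.
by split=> [/= ->|[x <-]] //; exists 0.
Qed.

Lemma proj_zero : projective (zero_lmod R).
Proof. exact: proj_free. Qed.

Lemma presents_proj P : projective P -> presents (zero_lmod R) P.
Proof. by move=> pP; have [i si] := ses_zero P; exists P, i, idfun. Qed.

Lemma proj_ext1 P : projective P -> ext1 P.
Proof.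
move=> pP; have [i si] := ses_zero P.
apply: (ext1_of_presentation pP si) => Q pQ g.
by exists \0 => x; rewrite [x]zero_lmodE !linear0.
Qed.

Lemma presents_iso K K' X X' :
  iso K K' -> iso X X' -> presents K X -> presents K' X'.
Proof.
move=> /iso_inv[f [f' [h1 h2]]] /iso_inv[g [g' [h3 h4]]] [P [i [q [pP sq]]]].
exists P, (i \o f'), (g \o q); split=> //.
by apply: ses_isor h3 h4 _; apply: ses_isol h2 h1 sq.
Qed.

Lemma presents_prod K X P :
  projective P -> presents K X -> presents K (X * P)%type.
Proof.
move=> pP [F [i [q [pF sq]]]].
have [i' [q' [sq' _ _]]] := @ses_prodr _ _ _ _ P _ _ sq.
by exists (F * P)%type, i', q'; split=> //; apply: proj_prod.
Qed.

Lemma presents_prodl K X P :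
  projective P -> presents K X -> presents (K * P)%type X.
Proof.
move=> pP [F [i [q [pF sq]]]].
have [i' [q' [sq' _ _]]] := @ses_prodl _ _ _ _ P _ _ sq.
by exists (F * P)%type, i', q'; split=> //; apply: proj_prod.
Qed.

(** Schanuel's lemma. *)
Lemma schanuel K K' P P' X (i : {linear K -> P}) (q : {linear P -> X})
    (i' : {linear K' -> P'}) (q' : {linear P' -> X}) :
  projective P -> projective P' -> ses i q -> ses i' q' ->
  iso (K * P')%type (K' * P)%type.
Proof.
move=> pP pP' sq sq'; have [ii ei qs] := sq; have [ii' ei' qs'] := sq'.
have [l lE] := pP' P X q q' qs; have [l' lE'] := pP P' X q' q qs'.
have [c cE] := coprod_map i l.
have [|v vE] := linear_lift (t := snd \- (l' \o c)) ii'.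
  move=> [k p]; apply/ei'; rewrite linearB /= lE' cE linearD lE /=.
  by rewrite (ses0 k sq) add0r subrr.
have [f fE] := prod_map v c.
apply: (@iso_of_bij _ _ _ f).
  apply: linear_inj => -[k p]; rewrite fE => -[v0 c0].
  have p0 : p = 0.
    have := vE (k, p); rewrite v0 linear0 /= c0 linear0 subr0.
    by [].
  move: c0; rewrite cE /= p0 linear0 addr0 -(linear0 i) => /ii ->.
  by [].
move=> [k' p].
have [|k kE] := proj1 (ei (p - l (i' k' + l' p))).
  by rewrite linearB lE linearD lE' (ses0 k' sq') add0r subrr.
have cp : c (k, i' k' + l' p) = p by rewrite cE /= kE subrK.
exists (k, i' k' + l' p); rewrite fE cp; congr (_, _).
by apply: ii'; rewrite vE /= cp addrK.
Qed.

Lemma uniq_sum_sub (T : eqType) V (s t : seq T) (F : T -> V) :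
  uniq s -> uniq t -> {subset s <= t} -> (forall x, x \notin s -> F x = 0) ->
  \sum_(x <- t) F x = \sum_(x <- s) F x.
Proof.
move=> us ut st F0; rewrite (bigID (mem s)) /= addrC big1 => [|x /F0 //].
rewrite add0r -big_filter; apply/perm_big/uniq_perm => // [|x].
  exact: filter_uniq.
by rewrite mem_filter /=; case: (boolP (x \in s)) => // /st ->.
Qed.

(** Over any ring, free modules (finitely supported functions) present every
    module; the modules of a Gorenstein projective resolution need not be
    finitely generated. *)
Lemma presents_exists X : exists K, presents K X.
Proof.
pose S (f : X -> R^o) := exists s : seq X, forall x, x \notin s -> f x = 0.
have hS : submodP S.
  split; first by exists [::].
  move=> a f g [s sf] [t tg]; exists (s ++ t) => x.
  rewrite mem_cat negb_or => /andP[/sf fx /tg gx].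
  have -> : (a *: f + g) x = a *: f x + g x by [].
  by rewrite fx gx scaler0 addr0.
have [F [i [ii iE]]] := sub_lmod hS.
have supp k : exists s : seq X, uniq s /\ forall x, x \notin s -> i k x = 0.
  have [s hs] := proj2 (iE (i k)) (ex_intro _ k erefl).
  by exists (undup s); rewrite undup_uniq; split=> // x; rewrite mem_undup; apply: hs.
have ext A (a : X -> A) : exists h : {linear F -> A}, forall k s, uniq s ->
    (forall x, x \notin s -> i k x = 0) ->
    h k = \sum_(x <- s) (i k x : R) *: a x.
  have indep k s t : uniq s -> uniq t -> (forall x, x \notin s -> i k x = 0) ->
      (forall x, x \notin t -> i k x = 0) ->
      \sum_(x <- s) (i k x : R) *: a x = \sum_(x <- t) (i k x : R) *: a x.
    move=> us ut s0 t0.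
    have st : uniq (undup (s ++ t)) by apply: undup_uniq.
    rewrite -(@uniq_sum_sub _ A s (undup (s ++ t))) //.
    - by apply: uniq_sum_sub => // [x xt|x /t0 ->]; rewrite ?scale0r //
         mem_undup mem_cat xt orbT.
    - by move=> x xs; rewrite mem_undup mem_cat xs.
    - by move=> x /s0 ->; rewrite scale0r.
  have [k|y [s [us s0 ->]]|c k y k' y' [s [us s0 ->]] [t [ut t0 ->]]|h hE] :=
    @linear_of_graph R F A (fun k y => exists s, [/\ uniq s,
      forall x, x \notin s -> i k x = 0 & y = \sum_(x <- s) (i k x : R) *: a x]).
  - by have [s [us s0]] := supp k; exists (\sum_(x <- s) (i k x : R) *: a x), s.
  - by apply: big1 => x _; rewrite linear0 scale0r.
  - have st : uniq (undup (s ++ t)) by apply: undup_uniq.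
    exists (undup (s ++ t)); split=> // [x|].
      rewrite mem_undup mem_cat negb_or => /andP[/s0 kx /t0 k'x].
      rewrite linearP; have -> : (c *: i k + i k') x = c *: i k x + i k' x by [].
      by rewrite kx k'x scaler0 addr0.
    rewrite (indep k s (undup (s ++ t))) // => [|x]; last first.
      by rewrite mem_undup mem_cat negb_or => /andP[/s0].
    rewrite (indep k' t (undup (s ++ t))) // => [|x]; last first.
      by rewrite mem_undup mem_cat negb_or => /andP[_ /t0].
    rewrite scaler_sumr -big_split; apply: eq_bigr => x _ /=.
    by rewrite scalerA -scalerDl linearP.
  exists h => k s us s0; have [t [ut t0 ->]] := hE k; exact: indep.
have delta x : exists d : F, forall y, i d y = ((x == y)%:R : R).
  have [|d dE] := proj1 (iE (fun y => ((x == y)%:R : R))).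
    by exists [:: x] => y; rewrite inE eq_sym => /negbTE ->.
  by exists d => y; rewrite dE.
pose d x := projT1 (cid (delta x)).
have dE x y : i (d x) y = ((x == y)%:R : R) by rewrite /d; case: cid.
have [q qE] := ext X id.
have qs : surj q.
  move=> x; exists (d x); rewrite (qE _ [:: x]) // => [|y].
    by rewrite big_seq1 dE eqxx scale1r.
  by rewrite inE dE eq_sym => /negbTE ->.
have [K [j sj]] := kernel_ses qs; exists K, F, j, q; split=> //.
move=> A B g f gs.
pose a x := projT1 (cid (gs (f (d x)))).
have aE x : g (a x) = f (d x) by rewrite /a; case: cid.
have [h hE] := ext A a; exists h => k; have [s [us s0]] := supp k.
rewrite (hE k s) // linear_sum.
have {2}-> : k = \sum_(x <- s) (i k x : R) *: d x.
  apply: ii; apply/funext => y; rewrite linear_sum.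
  have -> : (\sum_(x <- s) i ((i k x : R) *: d x)) y =
            \sum_(x <- s) (i k x : R) * ((x == y)%:R : R).
    rewrite fct_sumE; apply: eq_bigr => x _.
    by rewrite linearZ /= -dE.
  have [ys|ys] := boolP (y \in s); last first.
    rewrite s0 // big_seq big1 // => x xs.
    by case: eqP ys xs => [<- /negbTE ->|]; rewrite ?mulr0.
  rewrite (bigD1_seq y) //= eqxx mulr1 big1 ?addr0 // => x /negbTE ->.
  by rewrite mulr0.
by rewrite linear_sum; apply: eq_bigr => x _; rewrite !linearZ aE.
Qed.

(** The lift of a presentation [P -> M] along [G -> M] has a mapping cone; its
    cycles [H] are at once a kernel of [G1 * P -> G] and an extension of [K'] by
    [K1].  This trades a resolution of [M] for one of its first syzygy that is
    shorter by one. *)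
Lemma cone K G M K1 G1 K' P (i : {linear K -> G}) (q : {linear G -> M})
    (i1 : {linear K1 -> G1}) (q1 : {linear G1 -> K})
    (i' : {linear K' -> P}) (q' : {linear P -> M}) :
  projective P -> ses i q -> ses i1 q1 -> ses i' q' ->
  exists H (iH : {linear H -> (G1 * P)%type}) (qH : {linear (G1 * P)%type -> G})
           (j : {linear K1 -> H}) (t : {linear H -> K'}),
    [/\ ses iH qH, ses j t & forall z, iH (j z) = (i1 z, 0)].
Proof.
move=> pP sq sq1 sq'; have [ii ei qs] := sq; have [ii1 ei1 qs1] := sq1.
have [ii' ei' qs'] := sq'.
have [l lE] := pP G M q q' qs.
have [w wE] := coprod_map (i \o q1) l.
have ws : surj w.
  move=> y; have [p pE] := qs' (q y).
  have [|k kE] := proj1 (ei (y - l p)); first by rewrite linearB lE pE subrr.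
  by have [x xk] := qs1 k; exists (x, p); rewrite wE /= xk kE subrK.
have [H [iH sH]] := kernel_ses ws; have [iiH eiH _] := sH.
have [|t tE] := linear_lift (t := snd \o iH) ii'.
  move=> h; apply/ei'; rewrite /= -lE.
  have := ses0 h sH; rewrite wE => /(congr1 q).
  by rewrite linearD /= (ses0 _ sq) add0r linear0.
have [|l1 l1E] := @mk_linear _ K1 (G1 * P)%type (fun z => (i1 z, 0)).
  by move=> a x y; rewrite linearP pair_lin scaler0 addr0.
have [|j jE] := linear_lift (t := l1) iiH.
  by move=> z; apply/eiH; rewrite l1E wE /= (ses0 _ sq1) !linear0 addr0.
exists H, iH, w, j, t; split=> //; last by move=> z; rewrite jE l1E.
split.
- apply: linear_inj => z jz0; have := jE z.
  rewrite jz0 linear0 l1E => -[] /esym; rewrite -{1}(linear0 i1) => /ii1.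
  exact.
- move=> h; split=> [th0|[z <-]]; last first.
    by apply: ii'; rewrite tE /= jE l1E linear0.
  have h2 : (iH h).2 = 0 by have := tE h; rewrite th0 linear0.
  have := ses0 h sH; rewrite wE /= h2 linear0 addr0 -(linear0 i) => /ii /ei1[z zE].
  by exists z; apply: iiH; rewrite jE l1E zE -h2; case: (iH h).
move=> k'; have [|k kE] := proj1 (ei (l (i' k'))); first by rewrite lE (ses0 _ sq').
have [x xk] := qs1 k.
have [|h hE] := proj1 (eiH (- x, i' k')).
  by rewrite wE /= !linearN /= xk kE addNr.
by exists h; apply: ii'; rewrite tE /= hE.
Qed.

(** Vanishing of [Ext^i(X, Q)] for all [i > 0] and all projective [Q], by
    dimension shifting: [X] lies in a class of modules without extensions by
    projectives that is closed under first syzygies. *)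
Definition ext_acyclic X : Prop :=
  exists C : lmodType R -> Prop, C X /\
    forall Y, C Y -> ext1 Y /\ forall K, presents K Y -> C K.

Lemma ext_acyclic1 X : ext_acyclic X -> ext1 X.
Proof. by move=> [C [CX hC]]; case: (hC X CX). Qed.

Lemma ext_acyclic_presents X K : ext_acyclic X -> presents K X -> ext_acyclic K.
Proof.
by move=> [C [CX hC]] pK; exists C; split=> //; have [_] := hC X CX; apply.
Qed.

(** By Schanuel's lemma one presentation of each module is enough: the class
    is enlarged to all modules stably isomorphic to one of its members. *)
Lemma ext_acyclic_coind (C : lmodType R -> Prop) :
  (forall Y, C Y -> ext1 Y /\ exists K, presents K Y /\ C K) ->
  forall X, C X -> ext_acyclic X.
Proof.
move=> hC X CX.
exists (fun Y => exists Z P P', [/\ C Z, projective P, projective P'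
  & iso (Y * P)%type (Z * P')%type]); split.
  by exists X, (zero_lmod R), (zero_lmod R); split=> //;
    [exact: proj_zero|exact: proj_zero|exact: iso_refl].
move=> Y [Z [P [P' [CZ pP pP' iYZ]]]].
have [eZ [KZ [pKZ CKZ]]] := hC Z CZ.
split.
  apply: (@ext1_fst Y P); apply: ext1_iso (iso_sym iYZ) _.
  exact: ext1_prod pKZ eZ pP'.
move=> K /(presents_prod pP)[F [i [q [pF sq]]]].
have /(presents_iso (iso_refl KZ) (iso_sym iYZ)) := presents_prod pP' pKZ.
move=> [F' [i' [q' [pF' sq']]]].
by exists KZ, F', F; split=> //; apply: schanuel sq sq'.
Qed.

Lemma ext_acyclic_iso X Y : iso X Y -> ext_acyclic X -> ext_acyclic Y.
Proof.
move=> iXY aX.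
apply: (ext_acyclic_coind (C := fun Z => exists2 X, iso X Z & ext_acyclic X));
  last by exists X.
move=> Z [X' iX'Z aX']; split; first exact: ext1_iso iX'Z (ext_acyclic1 aX').
have [K pK] := presents_exists X'; exists K; split.
  exact: presents_iso (iso_refl K) iX'Z pK.
by exists K; [exact: iso_refl|exact: ext_acyclic_presents pK].
Qed.

Lemma ext_acyclic_prod X P :
  projective P -> ext_acyclic X -> ext_acyclic (X * P)%type.
Proof.
move=> pP aX.
apply: (@ext_acyclic_coind (fun Z => ext_acyclic Z \/
   exists2 Y : lmodType R, iso (Y * P)%type Z & ext_acyclic Y) _ (X * P)%type).
  move=> Z [aZ|[Y iYZ aY]].
    have [K pK] := presents_exists Z; split; first exact: ext_acyclic1.
    by exists K; split=> //; left; apply: ext_acyclic_presents pK.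
  have [K pK] := presents_exists Y; split.
    by apply: ext1_iso iYZ _; apply: ext1_prod pK (ext_acyclic1 aY) pP.
  exists K; split; last by left; apply: ext_acyclic_presents pK.
  by apply: presents_iso (iso_refl K) iYZ _; apply: presents_prod.
by right; exists X => //; apply: iso_refl.
Qed.

(** The kernels of epimorphisms between acyclic modules form a class as required
    by [ext_acyclic_coind]: [cone] shows that the first syzygy of such a kernel
    is one again, and it extends a map first to [H] and then to [P * PB]. *)
Lemma ext_acyclic_ker K A B (i : {linear K -> A}) (q : {linear A -> B}) :
  ses i q -> ext_acyclic A -> ext_acyclic B -> ext_acyclic K.
Proof.
move=> sq aA aB.
apply: (ext_acyclic_coind (C := fun K => exists A B (i : {linear K -> A})
  (q : {linear A -> B}), [/\ ses i q, ext_acyclic A & ext_acyclic B]));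
  last by exists A, B, i, q.
move=> {sq aA aB i q A B}K [A [B [i [q [sq aA aB]]]]].
have [K1 [P [i1 [q1 [pP sq1]]]]] := presents_exists K.
have [B1 [PB [iB [qB [pPB sqB]]]]] := presents_exists B.
have [H [iH [qH [j [t [sH sj jE]]]]]] := cone pPB sq sq1 sqB.
have pH : presents H A.
  by exists (P * PB)%type, iH, qH; split=> //; apply: proj_prod.
have aB1 : ext_acyclic B1.
  by apply: ext_acyclic_presents aB _; exists PB, iB, qB.
split.
  apply: (ext1_of_presentation pP sq1) => Q pQ g.
  have [h hE] := ext_acyclic1 aB1 pQ sj g.
  have [h' hE'] := ext_acyclic1 aA pQ sH h.
  have [|l lE] := @mk_linear _ P (P * PB)%type (fun x => (x, 0)).
    by move=> a x y; rewrite pair_lin scaler0 addr0.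
  by exists (h' \o l) => x; rewrite /= lE -jE hE' hE.
exists K1; split; first by exists P, i1, q1.
by exists H, B1, j, t; split=> //; apply: ext_acyclic_presents pH.
Qed.

(** * Syzygies of modules without extensions by projectives *)

(** A projective summand of the syzygy would extend to a summand of the
    projective cover that lies in the superfluous kernel. *)
Lemma syzygy_no_proj_summand X K : ext1 X -> is_syzygy X K -> no_proj_summand K.
Proof.
move=> eX [P [f [i [[pP fs fsup] ii ei]]]] Q Y pQ /iso_inv[a [b [ab ba]]] x.
have sf : ses i f by split.
have [h hE] := eX Q pQ _ _ i f sf (fst \o a).
have [|l lE] := @mk_linear _ Q (Q * Y)%type (fun x => (x, 0)).
  by move=> c y z; rewrite pair_lin scaler0 addr0.
pose j : {linear Q -> P} := i \o (b \o l).
have hj y : h (j y) = y by rewrite hE /= ba lE.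
have h0 y : h y = 0.
  apply/asboolP; apply: (fsup [pred y | `[< h y = 0 >]]) => [|z].
    exact: submodP_closed (ker_submod h).
  exists (z - j (h z)), (j (h z)); split; last by rewrite subrK.
    by apply/asboolP; rewrite linearB hj subrr.
  exact: ses0 sf.
by rewrite -(hj x) h0.
Qed.

Hypothesis hR : left_artinian R.

(** An endomorphism of a presentation that is the identity on the kernel induces
    on [X] the identity up to a map through a projective module. *)
Lemma endo_bij_of_ker_id K P X (i : {linear K -> P}) (q : {linear P -> X})
    (c : {linear P -> P}) (w : {linear X -> X}) :
  fin_gen X -> no_proj_summand X -> projective P -> ses i q ->
  (forall x, c (i x) = i x) -> (forall y, w (q y) = q (c y)) ->
  injective w /\ surj w.
Proof.
move=> gX nX pP [ii ei qs] ci wq.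
have [|s sE] := linear_factor (t := idfun \- c) qs.
  by move=> y /ei[x <-] /=; rewrite ci subrr.
apply: (one_minus_through_proj (s := s) (t := q) hR gX pP nX) => x.
by have [y <-] := qs x; rewrite sE linearB /= wq.
Qed.

(** Since [Ext^1] vanishes, an isomorphism of syzygies extends to the
    presentations in both directions.  The composites on [X] and [Y] are
    invertible by [endo_bij_of_ker_id]. *)
Lemma iso_of_syzygy_iso X Y K L :
  fin_gen X -> fin_gen Y -> no_proj_summand X -> no_proj_summand Y ->
  ext1 X -> ext1 Y -> presents K X -> presents L Y -> iso K L -> iso X Y.
Proof.
move=> gX gY nX nY eX eY [P [i [q [pP sq]]]] [P' [i' [q' [pP' sq']]]].
move=> /iso_inv[a [b [ab ba]]].
have [a' aE] := eX P' pP' _ _ i q sq (i' \o a).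
have [b' bE] := eY P pP _ _ i' q' sq' (i \o b).
have [_ ei qs] := sq; have [_ ei' qs'] := sq'.
have [|u uE] := linear_factor (t := q' \o a') qs.
  by move=> y /ei[x <-]; rewrite /= aE /= (ses0 _ sq').
have [|v vE] := linear_factor (t := q \o b') qs'.
  by move=> y /ei'[x <-]; rewrite /= bE /= (ses0 _ sq).
have [vu_inj _] : injective (v \o u) /\ surj (v \o u).
  apply: (endo_bij_of_ker_id (c := b' \o a') gX nX pP sq) => x /=.
    by rewrite aE /= bE /= ab.
  by rewrite uE /= vE.
have [_ uv_surj] : injective (u \o v) /\ surj (u \o v).
  apply: (endo_bij_of_ker_id (c := a' \o b') gY nY pP' sq') => x /=.
    by rewrite bE /= aE /= ba.
  by rewrite vE /= uE.
apply: (@iso_of_bij _ _ _ u); first exact: (inj_compr vu_inj).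
by move=> y; have [x <-] := uv_surj y; exists (v x).
Qed.

End Ext.

(** * Gorenstein projective modules and resolutions *)

Section Gorenstein.
Variable R : pzRingType.
Implicit Types A B E F G H K L M N P Q V X Y Z : lmodType R.

(** A class without extensions by projectives whose members have both a syzygy
    and a cosyzygy in the class consists of Gorenstein projective modules.  The
    complete resolution is spliced from sequences [Z (i + 1) -> T i -> Z i], where
    [Z] iterates syzygies for [i > 0] and cosyzygies for [i < 0]; since [Z i] has no
    extensions by projectives, the functors [Hom(_, Q)] keep it exact. *)
Lemma Gorenstein_projective_coind (C : lmodType R -> Prop) :
  (forall Y, C Y -> [/\ ext1 Y, exists K, presents K Y /\ C K
                      & exists Z, presents Y Z /\ C Z]) ->
  forall X, C X -> Gorenstein_projective X.
Proof.
move=> hC X CX.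
have down (Y : {Y | C Y}) : exists K : {Y | C Y}, presents (sval K) (sval Y).
  case: Y => Y CY; have [_ [K [pK CK]] _] := hC Y CY.
  by exists (exist _ K CK).
have up (Y : {Y | C Y}) : exists Z : {Y | C Y}, presents (sval Y) (sval Z).
  case: Y => Y CY; have [_ _ [Z [pZ CZ]]] := hC Y CY.
  by exists (exist _ Z CZ).
pose dn y := projT1 (cid (down y)); pose u y := projT1 (cid (up y)).
have dnP y : presents (sval (dn y)) (sval y) by rewrite /dn; case: cid.
have uP y : presents (sval y) (sval (u y)) by rewrite /u; case: cid.
pose X0 : {Y | C Y} := exist _ X CX.
pose z (i : int) := match i with
  | Posz n => iter n dn X0
  | Negz n => iter n.+1 u X0 end.
pose Z i := sval (z i).
have pz i j : j = i + 1 -> presents (Z j) (Z i).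
  move=> ->; case: i => [n|[|n]].
  - by rewrite -PoszD addn1; apply: dnP.
  - exact: uP.
  - have -> : Negz n.+1 + 1 = Negz n by rewrite !NegzE -addn1 PoszD opprD subrK.
    exact: uP.
pose T i := projT1 (cid (pz i _ erefl)).
have hT i : exists (j : {linear Z (i + 1) -> T i}) (q : {linear T i -> Z i}),
    projective (T i) /\ ses j q by rewrite /T; case: cid.
pose j i := projT1 (cid (hT i)).
have hj i : exists q : {linear T i -> Z i}, projective (T i) /\ ses (j i) q.
  by rewrite /j; case: cid.
pose q i := projT1 (cid (hj i)).
have hq i : projective (T i) /\ ses (j i) (q i) by rewrite /q; case: cid.
have pT i : projective (T i) by case: (hq i).
have sT i : ses (j i) (q i) by case: (hq i).
pose d i : {linear T (i + 1) -> T i} := j i \o q (i + 1).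
have dd i x : d i (d (i + 1) x) = 0.
  by rewrite /d /= (ses0 _ (sT (i + 1))) linear0.
exists T, d, (q 0); split.
- split=> // [i y|Q pQ i g].
    split=> [|[x <-]]; last exact: dd.
    have [ii _ _] := sT i; rewrite -(linear0 (j i)) => /ii.
    have [_ ei _] := sT (i + 1); move=> /ei[x <-].
    by have [_ _ qs] := sT (i + 1 + 1); have [w <-] := qs x; exists w.
  split=> [gd|[h hE] x]; last by rewrite -hE dd linear0.
  have [_ ei qs] := sT (i + 1).
  have [|g' gE] := linear_factor (t := g) qs.
    move=> y /ei[x <-]; have [_ _ qs'] := sT (i + 1 + 1).
    by have [w <-] := qs' x; exact: gd.
  have [eZ _ _] := hC _ (svalP (z i)).
  have [h hE] := eZ Q pQ _ _ _ _ (sT i) g'.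
  by exists h => x; rewrite /d /= hE gE.
- by case: (sT 0).
move=> y; have [_ ei _] := sT 0; split=> [/ei[x <-]|[x <-]]; last first.
  exact: ses0 (sT 0).
by have [_ _ qs] := sT (0 + 1); have [w <-] := qs x; exists w.
Qed.

(** The cokernels at all spots of all totally acyclic complexes form a class as
    required by [ext_acyclic_coind]. *)
Lemma Gorenstein_projective_acyclic X : Gorenstein_projective X -> ext_acyclic X.
Proof.
move=> [T [d [e [tT es ex]]]].
apply: (@ext_acyclic_coind R (fun Y : lmodType R =>
    exists (T : int -> lmodType R) (d : forall i, {linear T (i + 1) -> T i})
    (i : int) (e : {linear T i -> Y}),
    [/\ totally_acyclic d, surj e & exact_at (d i) e]) _ X); last first.
  by exists T, d, 0, e.
move=> {X T d e tT es ex}Y [T [d [i [e [[pT aT hT] es ex]]]]].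
have [K [k sk]] := kernel_ses es; have [kk ek _] := sk.
have [|c cE] := linear_lift (t := d i) kk; first by move=> x; apply/ek/ex; exists x.
have cs : surj c.
  move=> y; have /ek/ex[x xE] : exists x, k x = k y by exists y.
  by exists x; apply: kk; rewrite cE.
have ec : exact_at (d (i + 1)) c.
  move=> y; rewrite -(aT i y) -cE; split=> [->|]; first exact: linear0.
  by rewrite -(linear0 k) => /kk.
split; last first.
  exists K; split; first by exists (T i), k, e.
  by exists T, d, (i + 1), c.
apply: (ext1_of_presentation (pT i) sk) => Q pQ g.
have [h hE] : exists h : {linear T i -> Q}, forall x, h (d i x) = (g \o c) x.
  apply/(hT Q pQ i) => x /=; have -> : c (d (i + 1) x) = 0 by apply/ec; exists x.
  exact: linear0.
by exists h => y; have [x <-] := cs y; rewrite cE hE.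
Qed.

Lemma projective_Gorenstein P : projective P -> Gorenstein_projective P.
Proof.
move=> pP; apply: (@Gorenstein_projective_coind (@projective R) _ P) => // Y pY.
have p0 := @proj_zero R.
split; first exact: proj_ext1.
  by exists (zero_lmod R); split=> //; apply: presents_proj.
exists (zero_lmod R); split=> //; exists Y, idfun, \0; split=> //; split=> //.
- by move=> y; split=> // _; exists y.
- by move=> y; exists 0; rewrite [y]zero_lmodE.
Qed.

Lemma iso_prod_zero X : iso (X * zero_lmod R)%type X.
Proof.
apply: (@iso_of_bij R _ _ fst) => [[x y] [x' y'] /= ->|x]; last by exists (x, 0).
by rewrite [y]zero_lmodE [y']zero_lmodE.
Qed.

Lemma Gproj_resolution0 M : Gorenstein_projective M -> Gproj_resolution M 0.
Proof.
move=> gM.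
pose G (i : nat) : lmodType R := if i is _.+1 then zero_lmod R else M.
exists G, (fun i => \0 : {linear G i.+1 -> G i}).
exists (idfun : {linear G 0 -> M}); split.
- by case.
- by case=> // n _ x; apply: zero_lmodE.
- by move=> y; exists y.
- by move=> y; split=> [/= ->|[x <-]] //; exists 0.
- move=> i y; split=> _; first by exists 0; rewrite [y]zero_lmodE linear0.
  by case: i y => [|i] y.
Qed.

Lemma Gproj_resolutionS M K r : presents K M -> Gproj_resolution K r ->
  Gproj_resolution M r.+1.
Proof.
move=> [P [i [q [pP [ii ei qs]]]]] [G [d [e [gG G0 es ed ex]]]].
pose G' (k : nat) : lmodType R := if k is k'.+1 then G k' else P.
pose d' (k : nat) : {linear G' k.+1 -> G' k} :=
  match k return {linear G' k.+1 -> G' k} with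
  | 0 => (i \o e : {linear G 0 -> P})
  | k'.+1 => d k'
  end.
exists G', d', q; split=> //.
- by case=> [_|k /gG //]; apply: projective_Gorenstein.
- by case=> // k /G0.
- move=> y; split=> [/ei[x <-]|[x <-] /=]; last by apply/ei; exists (e x).
  by have [w <-] := es x; exists w.
case=> [|k]; last exact: ex.
move=> y; apply: iff_trans (ed y); split=> /= [|->]; last exact: linear0.
by rewrite -(linear0 i) => /ii.
Qed.

Lemma Gproj_resolution_split M r : Gproj_resolution M r.+1 ->
  exists K G (i : {linear K -> G}) (q : {linear G -> M}),
    [/\ ses i q, Gorenstein_projective G & Gproj_resolution K r].
Proof.
move=> [G [d [e [gG G0 es ed ex]]]].
have [K [i sq]] := kernel_ses es; have [ii ei _] := sq.
have [|c cE] := linear_lift (t := d 0) ii; first by move=> x; apply/ei/ed; exists x.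
exists K, (G 0), i, e; split=> //; first exact: gG.
exists (fun k => G k.+1), (fun k => d k.+1), c; split=> //.
- by move=> k kr; apply: gG.
- by move=> k rk; apply: G0.
- move=> y; have /ei/ed[x xE] : exists x, i x = i y by exists y.
  by exists x; apply: ii; rewrite cE.
- move=> y; rewrite -(ex 0 y) -cE; split=> [->|]; first exact: linear0.
  by rewrite -(linear0 i) => /ii.
Qed.

(** Resolutions whose terms are only required to be acyclic for extensions by
    projectives; passing to a syzygy of the resolved module shortens them. *)
Fixpoint acyclic_resolution r M : Prop :=
  if r is r'.+1 then
    exists K G (i : {linear K -> G}) (q : {linear G -> M}),
      [/\ ses i q, ext_acyclic G & acyclic_resolution r' K]
  else ext_acyclic M.

Lemma Gproj_acyclic_resolution r M :
  Gproj_resolution M r -> acyclic_resolution r M.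
Proof.
elim: r M => [|r IH] M.
  move=> [G [d [e [gG G0 es ed ex]]]].
  apply: ext_acyclic_iso (Gorenstein_projective_acyclic (gG 0 (leqnn 0))).
  apply: iso_of_bij es; apply: linear_inj => x /ed[y <-].
  by rewrite (G0 1 isT y) linear0.
move=> /Gproj_resolution_split[K [G [i [q [sq gG /IH rK]]]]].
by exists K, G, i, q; split=> //; apply: Gorenstein_projective_acyclic.
Qed.

(** The first term of the new resolution is the module [H] of [cone]; it is
    acyclic as a kernel of an epimorphism between acyclic modules. *)
Lemma acyclic_resolution_presents r M K : acyclic_resolution r M ->
  presents K M -> acyclic_resolution r.-1 K.
Proof.
case: r => [|r] /=; first exact: ext_acyclic_presents.
move=> [L [G [i [q [sq aG rL]]]]] [P [i' [q' [pP sq']]]].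
case: r rL => [|r] /= aL.
  have [i0 si0] := ses_zero L.
  have [H [iH [qH [j [t [sH [ij ej ts] jE]]]]]] := cone pP sq si0 sq'.
  apply: (@ext_acyclic_iso _ H).
    apply: iso_of_bij ts; apply: linear_inj => h /ej[z <-].
    by rewrite [z]zero_lmodE linear0.
  by apply: ext_acyclic_ker sH _ aG; apply: ext_acyclic_prod.
have [L1 [G1 [i1 [q1 [sq1 aG1 rL1]]]]] := aL.
have [H [iH [qH [j [t [sH st jE]]]]]] := cone pP sq sq1 sq'.
exists L1, H, j, t; split=> //.
by apply: ext_acyclic_ker sH _ aG; apply: ext_acyclic_prod.
Qed.

Hypothesis hR : left_artinian R.

Section Omegas.
Variables (M : lmodType R) (gM : fin_gen M).

Lemma OmegaD a b : Omega (a + b) M = Omega a (Omega b M).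
Proof. exact: iterD. Qed.

Lemma Omega_presents k : presents (Omega k.+1 M) (Omega k M).
Proof.
have gk := fin_gen_Omega hR k gM.
have [P [f [i [[pP _ _] _ sf]]]] := syzygy_ses (syzygyP hR gk) gk.
by exists P, i, f.
Qed.

Lemma Omega_resolution k r :
  Gproj_resolution (Omega k M) r -> Gproj_resolution M (k + r).
Proof.
elim: k r => [|k IH] r //= rk; rewrite addSnnS; apply: IH.
exact: Gproj_resolutionS (Omega_presents k) rk.
Qed.

Lemma Omega_ext_acyclic r k : Gproj_resolution M r -> (r <= k)%N ->
  ext_acyclic (Omega k M).
Proof.
move=> /Gproj_acyclic_resolution rM rk.
have : acyclic_resolution (r - k) (Omega k M).
  elim: k {rk} => [|k IH]; first by rewrite subn0.
  rewrite subnS; exact: acyclic_resolution_presents IH (Omega_presents k).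
by move/eqP: rk => ->.
Qed.

Lemma Omega_no_proj_summand k :
  ext1 (Omega k M) -> no_proj_summand (Omega k.+1 M).
Proof.
move=> eM; apply: syzygy_no_proj_summand eM _.
exact/(syzygyP hR)/(fin_gen_Omega hR).
Qed.

Lemma periodic_Omega k p : iso (Omega (k + p) M) (Omega k M) ->
  forall m, (k <= m)%N -> forall c, iso (Omega (m + c * p) M) (Omega m M).
Proof.
move=> ikp m /subnKC <-; set a := (m - k)%N.
elim=> [|c IH]; first by rewrite mul0n addn0; apply: iso_refl.
apply: iso_trans _ IH.
have -> : (k + a + c.+1 * p = (a + c * p) + (k + p))%N.
  by rewrite mulSn -!addnA [(k + (a + _))%N]addnCA; congr addn;
     rewrite [RHS]addnCA; congr addn; rewrite addnC.
have -> : (k + a + c * p = (a + c * p) + k)%N by rewrite -addnA addnC.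
rewrite OmegaD [X in iso _ X]OmegaD; apply: (Omega_iso hR) ikp.
exact: (fin_gen_Omega hR).
Qed.

(** By periodicity such a syzygy is also a syzygy of degree at least [r], hence
    has no extensions by projectives; running through the period in both
    directions produces a complete resolution.  The projective summand [Q] is
    carried along. *)
Lemma periodic_Gorenstein k p r m Q Y : (0 < p)%N -> Gproj_resolution M r ->
  iso (Omega (k + p) M) (Omega k M) -> (k <= m)%N -> projective Q ->
  iso (Omega m M * Q)%type Y -> Gorenstein_projective Y.
Proof.
move=> p0 rM ikp km pQ iY.
have per := periodic_Omega ikp.
apply: (@Gorenstein_projective_coind (fun Y : lmodType R =>
    exists2 m, (k <= m)%N & exists2 Q : lmodType R, projective Q &
      iso (Omega m M * Q)%type Y) _ Y); last first.
  by exists m => //; exists Q.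
move=> {m Q km pQ iY} {}Y [m km [Q pQ iY]].
have am : ext_acyclic (Omega m M).
  apply: ext_acyclic_iso (per m km r) _; apply: (Omega_ext_acyclic rM).
  by apply: leq_trans (leq_addl _ _); apply: leq_pmulr.
split.
- apply: ext1_iso iY _.
  exact: ext1_prod (Omega_presents m) (ext_acyclic1 am) pQ.
- exists (Omega m.+1 M); split.
    apply: presents_iso (iso_refl _) iY _.
    exact: presents_prod pQ (Omega_presents m).
  exists m.+1; first exact: leqW.
  exists (zero_lmod R); first exact: proj_zero.
  exact: iso_prod_zero.
exists (Omega (m + p.-1) M); split.
  apply: presents_iso _ (iso_refl _) (presents_prodl pQ (Omega_presents _)).
  apply: iso_trans iY; apply: iso_prod (iso_refl _).
  by have := per m km 1%N; rewrite mul1n -addnS prednK.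
exists (m + p.-1)%N; first by apply: leq_trans (leq_addr _ _).
exists (zero_lmod R); first exact: proj_zero.
exact: iso_prod_zero.
Qed.

Hypotheses (r p : nat) (p0 : (0 < p)%N) (rM : Gproj_resolution M r).

Let ext1_Omega k : (r <= k)%N -> ext1 (Omega k M).
Proof. by move=> rk; apply/ext_acyclic1/(Omega_ext_acyclic rM). Qed.

(** Beyond degree [r] syzygies have no projective summands, so [iso_of_syzygy_iso]
    recovers each of them from the next one; periodicity descends step by step. *)
Lemma periodic_descent n : iso (Omega (n + p) M) (Omega n M) ->
  iso (Omega (r.+1 + p) M) (Omega r.+1 M).
Proof.
move=> ip; have [rn|nr] := leqP n r.+1.
  by have := periodic_Omega ip rn 1; rewrite mul1n.
have {nr} : (r.+1 <= n)%N by apply: ltnW.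
move=> /subnKC nE; move: ip; rewrite -nE; elim: (n - r.+1)%N => [|k IH].
  by rewrite addn0.
rewrite addnS addSn => ip; apply: IH; move: ip.
set a := (r.+1 + k)%N; have ra : (r < a)%N by apply: leq_addr.
case: a ra => // a ra.
have rap : (r <= a + p)%N by apply: leq_trans (leq_addr _ _).
apply: (iso_of_syzygy_iso hR); try exact: (fin_gen_Omega hR).
- by apply: Omega_no_proj_summand; apply: ext1_Omega.
- by apply: Omega_no_proj_summand; apply: ext1_Omega.
- by apply: ext1_Omega; apply: leqW.
- by apply: ext1_Omega; apply: leqW.
- exact: Omega_presents.
- exact: Omega_presents.
Qed.

(** [X] and the syzygy of degree [r + p] have isomorphic first syzygies by
    [periodic_descent], and neither of them has a projective summand. *)
Lemma periodic_summand n X Q : iso (Omega (n + p) M) (Omega n M) ->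
  fin_gen X -> no_proj_summand X -> projective Q ->
  iso (Omega r M) (X * Q)%type -> iso X (Omega (r + p) M).
Proof.
move=> /periodic_descent ip gX nX pQ iXQ.
have rp : (r + p)%N = (r + p.-1).+1 by rewrite -addnS prednK.
apply: (iso_of_syzygy_iso hR (K := syzygy X) (L := Omega (r + p).+1 M)) => //.
- exact: (fin_gen_Omega hR).
- by rewrite rp; apply: Omega_no_proj_summand; apply: ext1_Omega; apply: leq_addr.
- by apply: (@ext1_fst R X Q); apply: ext1_iso iXQ _; apply: ext1_Omega.
- by apply: ext1_Omega; apply: leq_addr.
- have [P [f [i [[pP _ _] _ sf]]]] := syzygy_ses (syzygyP hR gX) gX.
  by exists P, i, f.
- exact: Omega_presents.
apply: iso_trans (iso_sym ip).
have gr := fin_gen_Omega hR r gM.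
apply: is_syzygy_iso (is_syzygy_prod (syzygyP hR gX) pQ) (syzygyP hR gr) _.
exact: iso_sym.
Qed.

End Omegas.
End Gorenstein.

(** * Eventually periodic modules of finite Gorenstein projective dimension *)

Theorem corollary3p12 (R : pzRingType) (hR : left_artinian R)
    (M : lmodType R) (hM : fin_gen M) (n p r : nat)
    (hper : eventually_periodic n p M) (hG : Gpd_eq M r) :
  [/\ ((r <= n)%N /\ (n <= r + 1)%N) /\
      (exists P : lmodType R,
         [/\ fin_gen P, projective P &
             iso (Omega (r + p) M * P)%type (Omega r M)]),
      n = r <-> no_proj_summand (Omega r M) &
      (1 <= n)%N ->
      forall X Q : lmodType R,
        fin_gen X -> no_proj_summand X -> fin_gen Q -> projective Q ->
        iso (Omega (n - 1) M) (X * Q)%type ->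
        (r = (n - 1)%N <-> iso X (Omega (n + p - 1) M))].
Proof.
case: hper => _ nmin [p0 iOp _]; case: hG => rM rmin.
have ip : iso (Omega (n + p) M) (Omega n M) by rewrite addnC OmegaD.
have periodicE m : iso (Omega (m + p) M) (Omega m M) -> (n <= m)%N.
  by move=> im; apply: nmin; exists p => //; rewrite -OmegaD addnC.
have rn_of m : Gorenstein_projective (Omega m M) -> (r <= m)%N.
  move=> gm; apply: rmin; rewrite -[m]addn0.
  exact/(Omega_resolution hR hM)/Gproj_resolution0.
have gn m : (n <= m)%N -> forall Q Y, projective Q ->
    iso (Omega m M * Q)%type Y -> Gorenstein_projective Y.
  by move=> nm Q Y pQ; apply: (periodic_Gorenstein hR hM p0 rM ip nm pQ).
(* The syzygy of degree n is Gorenstein projective, so M has a Gorenstein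
   projective resolution of length n. *)
have rn : (r <= n)%N.
  apply: rn_of; apply: (gn n (leqnn n) _ _ (@proj_zero R)).
  exact: iso_prod_zero.
have nr : (n <= r.+1)%N.
  by apply: periodicE; apply: (periodic_descent hR hM rM ip).
have summand X Q := periodic_summand (X := X) (Q := Q) hR hM p0 rM ip.
have gr := fin_gen_Omega hR r hM.
split.
- split; first by rewrite addn1.
  have [X [Q [iXQ nX pQ]]] := split_proj_summand hR gr.
  have gXQ := fin_gen_iso iXQ gr.
  have iX := summand X Q (fin_gen_fst gXQ) nX pQ iXQ.
  exists Q; split=> //; first exact: fin_gen_snd gXQ.
  apply: iso_trans (iso_sym iXQ).
  exact: iso_prod (iso_sym iX) (iso_refl Q).
- split=> [nE|nX].
    rewrite -nE; apply: (no_proj_summand_iso ip); rewrite -(prednK p0) addnS.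
    apply: (Omega_no_proj_summand hR hM).
    apply/ext_acyclic1/(Omega_ext_acyclic hR hM rM).
    exact: leq_trans rn (leq_addr _ _).
  apply/eqP; rewrite eqn_leq rn andbT; apply: periodicE; apply: iso_sym.
  apply: (summand _ _ gr nX (@proj_zero R)).
  exact/iso_sym/iso_prod_zero.
move=> n1 X Q gX nX gQ pQ iXQ.
have npE : (n + p - 1 = n - 1 + p)%N by rewrite addnBAC.
split=> [rE|iX].
  by rewrite npE -rE; apply: (summand X Q) => //; rewrite rE.
(* The syzygy of degree n - 1 is the direct sum of Q and of a module isomorphic
   to a syzygy of degree at least n, hence Gorenstein projective. *)
apply/eqP; rewrite eqn_leq leq_subLR add1n nr andbT; apply: rn_of.
apply: (gn (n + p - 1)%N _ Q _ pQ).
  by rewrite npE -{1}(subnK n1) leq_add2l.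
apply: iso_trans (iso_sym iXQ).
exact: iso_prod (iso_sym iX) (iso_refl Q).
Qed.
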